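(* Fix $c\in\mathbb R$ and integers $p\ge1$ and $m\ge1$, with $m$ independent of $n$. Let $k=k_n(c):=\lfloor\frac nm(\log n+c)\rfloor$, and let $n\to\infty$. Then $$\mathrm{sep}\bigl((Q^{(m)})^{*k},U\bigr)=s_p(c)+o(1),$$ $$\left\|\frac{(Q^{(m)})^{*k}(\cdot)}{U(\cdot)}-1\right\|_{L^q(U)}^q=H_{q,p}(c)+o(1)\qquad(1\le q<\infty),$$ $$D\bigl((Q^{(m)})^{*k}\|U\bigr)=h_p(c)+o(1),$$ and, with convergence in the extended interval $[0,\infty]$, $$\left\|\frac{(Q^{(m)})^{*k}(\cdot)}{U(\cdot)}-1\right\|_{L^\infty(U)}\longrightarrow H_{\infty,p}(c).$$ In particular, $$\bigl\|(Q^{(m)})^{*k}-U\bigr\|_{\mathrm{TV}}=f_p(c)+o(1),\qquad\chi^2\bigl((Q^{(m)})^{*k},U\bigr)=g_p(c)+o(1).$$ Hence the walk with step law $Q^{(m)}$ has total-variation cutoff at $\frac nm\log n$ with window $\frac nm$. Furthermore, for the reversed chain $(Y_j)_{j\ge0}$ on $G_{n,p}$ ($n\ge m$): if $p\ge2$, then $\tau_{\mathrm{cov}}$ is an optimal strong stationary time and $$\mathbb P(\tau_{\mathrm{cov}}>j)=1-P_j^{(m)}(0)=\mathrm{sep}\bigl((Q^{(m)})^{*j},U\bigr)\qquad(j\ge0).$$ If $p=1$, then $\tau_{n-1}$ is an optimal strong stationary time and $$\mathbb P(\tau_{n-1}>j)=1-P_j^{(m)}(0)-P_j^{(m)}(1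)=\mathrm{sep}\bigl((Q^{(m)})^{*j},U\bigr)\qquad(j\ge0).$$
   Context: For integers $n,p\ge1$, $C_p=\mathbb Z/p\mathbb Z$ (written additively) and $G_{n,p}=C_p\wr S_n$ is the group of $p$-colored permutations, realized as $C_p^{\,n}\times S_n$ with multiplication $(t,\tau)(s,\sigma)=(\sigma t+s,\tau\sigma)$, $\sigma t:=(t_{\sigma(1)},\dots,t_{\sigma(n)})$. In $(s,\sigma)$, position $i$ carries the label $\sigma(i)$ with color $s_i$. $U$ is the uniform law on $G_{n,p}$. Convolution is $(M*N)(z)=\sum_uM(zu^{-1})N(u)$, $M^{*k}$ is the $k$-fold convolution power and $M^{*0}=\delta_e$. For $1\le m\le n$, $Q^{(m)}$ (one step of $p$-colored top-$m$-to-random) is the uniform law on the set of $(s,\sigma)\in G_{n,p}$ with $\sigma^{-1}(m+1)<\cdots<\sigma^{-1}(n)$ and $s_{\sigma^{-1}(j)}=0$ for $m+1\le j\le n$. Random walks multiply on the right by independent steps. Reversed chain: $\check Q^{(m)}(g):=Q^{(m)}(g^{-1})$, and $(Y_j)_{j\ge0}$ is the $\check Q^{(m)}$-walk started at $e$, realized as follows: each step chooses a uniform $m$-subset of the labels $[n]$, moves those labels to the first $m$ positions in uniform random order, recolors them independently and uniformly in $C_p$, and leaves all other labels in their relative order with their colors (all choices independent across steps). $T_j\subseteq[n]$ is the set of labels chosen in at least one of the first $j$ steps, $T_0=\varnothing$. $P_j^{(m)}(u):=\mathbb P(n-|T_j|=u)$, $\tau_{\mathrm{cov}}:=\min\{j:T_j=[n]\}$,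 $\tau_{n-1}:=\min\{j:|T_j|\ge n-1\}$. A strong stationary time is an almost surely finite stopping time $\tau$ (with respect to the filtration generated by the moves) with $\mathbb P(Y_\tau=y,\tau=j)=U(y)\,\mathbb P(\tau=j)$ for all $y,j$; it is optimal if $\mathbb P(\tau>j)=\mathrm{sep}(\mathrm{Law}(Y_j),U)$ for all $j\ge0$. For a probability measure $M$ on $G_{n,p}$: $\|M-U\|_{\mathrm{TV}}=\frac12\sum_x|M(x)-U(x)|$; $\mathrm{sep}(M,U)=1-\min_xM(x)/U(x)$; $\|f\|_{L^q(U)}=(\sum_x|f(x)|^qU(x))^{1/q}$ for $1\le q<\infty$ and $\|f\|_{L^\infty(U)}=\max_x|f(x)|$; $\chi^2(M,U)=\|M/U-1\|_{L^2(U)}^2$; $D(M\|U)=\sum_xM(x)\log\frac{M(x)}{U(x)}$ with $0\log0:=0$. Total-variation cutoff of $Q$ at times $t_n$ with window $b_n$ means: there is a nonincreasing $f:\mathbb R\to[0,1]$ with $f(c)\to1$ as $c\to-\infty$ and $f(c)\to0$ as $c\to+\infty$ such that $\|Q^{*\lfloor t_n+cb_n\rfloor}-U\|_{\mathrm{TV}}\to f(c)$ for each fixed $c\in\mathbb R$. For fixed $m,c$, $k_n(c)\ge0$ for all large $n$. Profile functions, with $\lambda=e^{-c}$ and $r=p\lambda$: $s(\ell):=e^{-\lambda}\sum_{u=0}^{\ell}r^u$, $\quad a_\ell:=\frac{1}{\ell!\,p^\ell}-\frac{1}{(\ell+1)!\,p^{\ell+1}}$, $\quad w^*:=\min\{\ell\ge0: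 s(\ell)>1\}$ (which exists and is $\ge1$), $$f_p(c):=1-e^{-\lambda}\sum_{u=0}^{w^*-1}\frac{\lambda^u}{u!}+\frac{e^{-\lambda}\sum_{u=0}^{w^*-1}r^u-1}{w^*!\,p^{w^*}},\qquad s_p(c):=\begin{cases}1-e^{-\lambda}(1+\lambda),&p=1,\\1-e^{-\lambda},&p\ge2,\end{cases}$$ $$H_{q,p}(c):=\sum_{\ell=0}^\infty a_\ell|s(\ell)-1|^q\ (1\le q<\infty),\qquad h_p(c):=\sum_{\ell=0}^\infty a_\ell\,s(\ell)\log s(\ell),$$ $$g_p(c):=\begin{cases}\frac{r+1}{r-1}e^{-\lambda(2-r)}-\frac{2}{r-1}e^{-\lambda}-1,&r\ne1,\\(2\lambda+1)e^{-\lambda}-1,&r=1,\end{cases}\qquad H_{\infty,p}(c):=\begin{cases}\frac{e^{-\lambda}}{1-r}-1,&r<1,\\+\infty,&r\ge1.\end{cases}$$ *)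

(* Defs.v *)
From HB Require Import structures.
From mathcomp Require Import all_boot all_order all_algebra all_fingroup.
From mathcomp Require Import all_classical all_reals all_analysis.
From mathcomp Require Import ring lra.
Set Implicit Arguments.
Unset Strict Implicit.
Unset Printing Implicit Defensive.
Import Order.TTheory GRing.Theory Num.Theory.
Import numFieldNormedType.Exports.
Local Open Scope classical_set_scope.
Local Open Scope ring_scope.

(* Z/p for p >= 1; unlike 'Z_p this is the trivial group for p = 1. *)
Notation Cp p := 'I_p.-1.+1.

(* In (s, sigma), position i carries the label sigma i with color s i. *)
Definition cperm (n p : nat) : Type := ({ffun 'I_n -> Cp p} * 'S_n)%type.
HB.instance Definition _ (n p : nat) := Finite.on (cperm n p).

Definition cperm_act (n p : nat) (sigma : 'S_n) (t : {ffun 'I_n -> Cp p}) :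
  {ffun 'I_n -> Cp p} := [ffun i => t (sigma i)].

(* (t, tau)(s, sigma) = (sigma t + s, tau o sigma); the product of 'S_n is
   (sigma * tau) i = tau (sigma i), hence the exchanged factors. *)
Definition cperm_mul (n p : nat) (x y : cperm n p) : cperm n p :=
  ([ffun i => cperm_act y.2 x.1 i + y.1 i], (y.2 * x.2)%g).

Definition cperm_one (n p : nat) : cperm n p := ([ffun=> 0], 1%g).

Definition cperm_inv (n p : nat) (x : cperm n p) : cperm n p :=
  ([ffun i => - cperm_act x.2^-1%g x.1 i], x.2^-1%g).

Lemma cperm_mulA (n p : nat) : associative (@cperm_mul n p).
Proof.
move=> [a1 a2] [b1 b2] [c1 c2]; congr pair; last by rewrite /= mulgA.
by apply/ffunP => i; rewrite !ffunE permM addrA.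
Qed.

Lemma cperm_mul1 (n p : nat) : left_id (@cperm_one n p) (@cperm_mul n p).
Proof.
move=> [s u]; congr pair; last by rewrite /= mulg1.
by apply/ffunP => i; rewrite !ffunE add0r.
Qed.

Lemma cperm_mulV (n p : nat) :
  left_inverse (@cperm_one n p) (@cperm_inv n p) (@cperm_mul n p).
Proof.
move=> [s u]; congr pair; last by rewrite /= mulgV.
by apply/ffunP => i; rewrite !ffunE permK addNr.
Qed.

HB.instance Definition _ (n p : nat) := Finite_isGroup.Build (cperm n p)
  (@cperm_mulA n p) (@cperm_mul1 n p) (@cperm_mulV n p).

Definition unif (R : realType) (T : finType) (A : {set T}) (x : T) : R :=
  (x \in A)%:R / #|A|%:R.
Arguments unif R {T} A x.

Definition U (R : realType) (G : finGroupType) : G -> R := unif R [set: G]%SET.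
Arguments U R {G} _.

Definition conv (R : realType) (G : finGroupType) (M N : G -> R) (z : G) : R :=
  \sum_(u : G) M (z * u^-1)%g * N u.

Definition convpow (R : realType) (G : finGroupType) (M : G -> R) (k : nat) :
  G -> R := iter k (fun N => conv N M) (fun x => (x == 1%g)%:R).

Definition tv (R : realType) (G : finGroupType) (M N : G -> R) : R :=
  2^-1 * \sum_(x : G) `|M x - N x|.

(* The value at the identity, used as default of the minimum, is one of the
   values over which the minimum is taken. *)
Definition sep (R : realType) (G : finGroupType) (M N : G -> R) : R :=
  1 - \big[Num.min/M 1%g / N 1%g]_(x : G) (M x / N x).

Definition lq_norm (R : realType) (G : finGroupType) (q : R) (f : G -> R) : R :=
  (\sum_(x : G) (`|f x| `^ q) * U R x) `^ q^-1.

Definition linf_norm (R : realType) (G : finGroupType) (f : G -> R) : R :=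
  \big[Num.max/0]_(x : G) `|f x|.

Definition reldens (R : realType) (G : finGroupType) (M : G -> R) (x : G) : R :=
  M x / U R x - 1.

Definition chi2 (R : realType) (G : finGroupType) (M : G -> R) : R :=
  lq_norm 2 (reldens M) ^+ 2.

Definition KL (R : realType) (G : finGroupType) (M N : G -> R) : R :=
  \sum_(x : G) M x * ln (M x / N x).

(* Labels and positions are 0-based: the labels m+1, ..., n are the j : 'I_n
   with m <= j. *)
Definition top_set (n p m : nat) : {set cperm n p} :=
  [set x : cperm n p |
    [forall i : 'I_n, forall j : 'I_n,
       ((m <= i) && (i < j))%N ==> (x.2^-1%g i < x.2^-1%g j)%N] &&
    [forall j : 'I_n, (m <= j)%N ==> (x.1 (x.2^-1%g j) == 0)]].

Definition Q (R : realType) (n p m : nat) : cperm n p -> R :=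
  unif R (top_set n p m).
Arguments Q R n p m : clear implicits.

Definition Qrev (R : realType) (n p m : nat) (g : cperm n p) : R :=
  Q R n p m g^-1%g.
Arguments Qrev R n p m : clear implicits.

(* Num.truncn is the floor on nonnegative reals and 0 on negative ones, where
   no convolution power is meant. *)
Definition kn (R : realType) (m : nat) (c : R) (n : nat) : nat :=
  Num.truncn (n%:R / m%:R * (ln n%:R + c)).

Definition tv_cutoff (R : realType) (G : nat -> finGroupType)
    (M : forall n, G n -> R) (t b : nat -> R) : Prop :=
  exists f : R -> R,
    [/\ {homo f : x y /~ x <= y},
        forall c, 0 <= f c <= 1,
        f x @[x --> -oo] --> (1 : R),
        f x @[x --> +oo] --> (0 : R)
      & forall c, tv (convpow (M n) (Num.truncn (t n + c * b n))) (U R)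
                    @[n --> \oo] --> f c].

Definition lam (R : realType) (c : R) : R := expR (- c).

Definition rr (R : realType) (p : nat) (c : R) : R := p%:R * lam c.

Definition sl (R : realType) (p : nat) (c : R) (l : nat) : R :=
  expR (- lam c) * \sum_(u < l.+1) rr p c ^+ u.

Definition al (R : realType) (p l : nat) : R :=
  (l`!%:R * p%:R ^+ l)^-1 - (l.+1`!%:R * p%:R ^+ l.+1)^-1.
Arguments al R p l : clear implicits.

Lemma sl_gt1 (R : realType) (p : nat) (c : R) :
  (0 < p)%N -> exists l, 1 < sl p c l.
Proof.
move=> hp; have l0 : 0 < lam c by exact: expR_gt0.
set e := lam c ^+ 2 / 2; have e0 : 0 < e by rewrite divr_gt0// exprn_gt0.
have /cvgrPdist_lt/(_ _ e0)[N _ hN] :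
    series (exp_coeff (lam c)) @ \oo --> expR (lam c).
  exact: is_cvg_series_exp_coeff.
have /= := hN (N + 3)%N (leq_addr _ _).
rewrite ltr_norml => /andP[_]; rewrite ltrBlDr => hlt.
exists (N + 2)%N; rewrite /sl expRN mulrC ltr_pdivlMr ?expR_gt0// mul1r.
apply: lt_le_trans hlt _.
rewrite /series /= big_mkord -addnS.
have ge0 i : 0 <= lam c ^+ i by rewrite exprn_ge0// ltW.
apply: (@le_trans _ _ (\sum_(i < N + 3) lam c ^+ i)); last first.
  have hr : lam c <= rr p c by rewrite /rr ler_peMl ?ler1n// ltW.
  apply: ler_sum => i _; rewrite lerXn2r ?nnegrE ?(ltW l0)//.
  exact: le_trans (ltW l0) hr.
have h2 : (2 < N + 3)%N by rewrite addnC.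
rewrite (bigD1 (Ordinal h2))//= [leRHS](bigD1 (Ordinal h2))//= addrA.
apply: lerD; first by rewrite /exp_coeff /= /e -splitr.
apply: ler_sum => i _; rewrite /exp_coeff /= ler_piMr//.
by rewrite invf_le1 ?ltr0n ?fact_gt0// ler1n fact_gt0.
Qed.

Definition wstar (R : realType) (p : nat) (hp : (0 < p)%N) (c : R) : nat :=
  ex_minn (sl_gt1 c hp).

Definition f_prof (R : realType) (p : nat) (hp : (0 < p)%N) (c : R) : R :=
  let w := wstar hp c in
  1 - expR (- lam c) * (\sum_(u < w) lam c ^+ u / u`!%:R)
  + (expR (- lam c) * (\sum_(u < w) rr p c ^+ u) - 1) / (w`!%:R * p%:R ^+ w).

Definition s_prof (R : realType) (p : nat) (c : R) : R :=
  if p == 1%N then 1 - expR (- lam c) * (1 + lam c) else 1 - expR (- lam c).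

Definition Hq_term (R : realType) (q : R) (p : nat) (c : R) (l : nat) : R :=
  al R p l * (`|sl p c l - 1| `^ q).

Definition Hq_prof (R : realType) (q : R) (p : nat) (c : R) : R :=
  limn (series (Hq_term q p c)).

Definition h_term (R : realType) (p : nat) (c : R) (l : nat) : R :=
  al R p l * (sl p c l * ln (sl p c l)).

Definition h_prof (R : realType) (p : nat) (c : R) : R :=
  limn (series (h_term p c)).

Lemma al_series_cvg (R : realType) (p : nat) (f : nat -> R) (C x : R) :
  (0 < p)%N -> 0 <= C -> 0 <= x -> (forall l, `|f l| <= C * x ^+ l) ->
  cvgn (series (fun l => al R p l * f l)).
Proof.
move=> hp C0 x0 hf; apply: normed_cvg.
pose v l : R := (l`!%:R * p%:R ^+ l)^-1; pose w l : R := l`!%:R^-1.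
have f0 l : (0 : R) < l`!%:R by rewrite ltr0n fact_gt0.
have h l : 0 <= v l <= w l.
  have hp1 : (1 : R) <= p%:R ^+ l by rewrite exprn_ege1// ler1n.
  have hfp : (0 : R) < l`!%:R * p%:R ^+ l.
    by rewrite mulr_gt0// (lt_le_trans ltr01).
  by rewrite invr_ge0 (ltW hfp)/= lef_pV2 ?posrE// ler_peMr// ltW.
have hS l : w l.+1 <= w l by rewrite lef_pV2 ?posrE// ler_nat leq_fact.
apply: (@series_le_cvg _ _ (fun l => C * exp_coeff x l)) => [l|l|l|].
- exact: normr_ge0.
- by rewrite mulr_ge0// exp_coeff_ge0.
- rewrite [leLHS](_ : _ = `|al R p l| * `|f l|); last exact: normrM.
  rewrite /exp_coeff /= mulrA [leRHS]mulrC ler_pM//.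
  have := h l; have := h l.+1; have := hS l.
  by rewrite ler_norml /al -/(v l) -/(v l.+1) -/(w l); lra.
- exact: is_cvg_seriesZ (is_cvg_series_exp_coeff x).
Qed.

Lemma sl_bounds (R : realType) (p : nat) (c : R) (l : nat) :
  expR (- lam c) <= sl p c l <= (2 * (1 + rr p c)) ^+ l.
Proof.
have r0 : 0 <= rr p c by rewrite mulr_ge0// expR_ge0.
apply/andP; split.
  rewrite /sl big_ord_recl expr0 ler_peMr ?expR_ge0// lerDl.
  by rewrite sumr_ge0// => i _; rewrite exprn_ge0.
apply: (@le_trans _ _ (\sum_(u < l.+1) (1 + rr p c) ^+ l)).
  rewrite /sl; apply: (@le_trans _ _ (1 * \sum_(u < l.+1) rr p c ^+ u)).
    rewrite ler_wpM2r ?sumr_ge0// => [i _|]; first by rewrite exprn_ge0.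
    by rewrite -expR0 ler_expR oppr_le0 expR_ge0.
  rewrite mul1r; apply: ler_sum => i _.
  apply: (@le_trans _ _ ((1 + rr p c) ^+ i)).
    by rewrite lerXn2r ?nnegrE ?addr_ge0// lerDr.
  by rewrite ler_weXn2l ?lerDl// -ltnS.
rewrite sumr_const card_ord exprMn -[leLHS]mulr_natl ler_wpM2r//.
  by rewrite exprn_ge0// addr_ge0.
by rewrite -natrX ler_nat ltn_expl.
Qed.

Lemma Hq_series_cvg (R : realType) (q : R) (p : nat) (c : R) :
  (0 < p)%N -> 1 <= q -> cvgn (series (Hq_term q p c)).
Proof.
move=> hp hq; set K := 2 * (1 + rr p c).
have K1 : 1 <= K.
  by have : 0 <= rr p c by [rewrite mulr_ge0// expR_ge0]; rewrite /K; lra.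
apply: (@al_series_cvg _ _ _ 1 (K `^ q)) => // [|l]; first exact: powR_ge0.
have [h1 h2] := andP (sl_bounds p c l); rewrite -/K in h2.
have K1l : 1 <= K ^+ l by rewrite exprn_ege1.
have -> : 1 * (K `^ q) ^+ l = (K ^+ l) `^ q.
  by rewrite mul1r -!powR_mulrn ?powR_ge0 ?(le_trans ler01)// -!powRrM mulrC.
rewrite ger0_norm ?powR_ge0//.
apply: ge0_ler_powR; rewrite ?nnegrE ?(le_trans ler01 hq) ?(le_trans ler01 K1l)//.
by have := expR_ge0 (- lam c); rewrite ler_norml; lra.
Qed.

Lemma h_series_cvg (R : realType) (p : nat) (c : R) :
  (0 < p)%N -> cvgn (series (h_term p c)).
Proof.
move=> hp; set K := 2 * (1 + rr p c).
have K1 : 1 <= K.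
  by have : 0 <= rr p c by [rewrite mulr_ge0// expR_ge0]; rewrite /K; lra.
have l0 : 0 <= lam c by exact: expR_ge0.
apply: (@al_series_cvg _ _ _ (1 + lam c) (K ^+ 2)) => // [||l].
- by rewrite addr_ge0.
- by rewrite exprn_ge0// (le_trans ler01).
have [h1 h2] := andP (sl_bounds p c l); rewrite -/K in h2.
have s0 : 0 < sl p c l by rewrite (lt_le_trans _ h1)// expR_gt0.
have K1l : 1 <= K ^+ l by rewrite exprn_ege1.
rewrite -exprM mulnC exprM expr2 mulrCA normrM ler_pM// ?(gtr0_norm s0)//.
rewrite ler_norml; have := ln_sublinear s0.
have : - lam c <= ln (sl p c l) by rewrite -[leLHS]expRK ler_ln ?posrE ?expR_gt0.
nra.
Qed.

Definition g_prof (R : realType) (p : nat) (c : R) : R :=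
  let l := lam c in let r := rr p c in
  if r == 1 then (2 * l + 1) * expR (- l) - 1
  else (r + 1) / (r - 1) * expR (- (l * (2 - r)))
       - 2 / (r - 1) * expR (- l) - 1.

Definition Hinf_prof (R : realType) (p : nat) (c : R) : \bar R :=
  if rr p c < 1 then (expR (- lam c) / (1 - rr p c) - 1)%:E else +oo%E.

(* The labels in positions 0, 1, ..., with their colors. *)
Definition deck (n p : nat) (g : cperm n p) : seq ('I_n * Cp p) :=
  [seq (g.2 i, g.1 i) | i <- enum 'I_n].

(* An m-subset of labels, the order in which it is put on top and the new
   colors; the uniform law on this product makes the three choices (and the
   colors) uniform and independent. *)
Definition move (n p m : nat) : Type :=
  ({A : {set 'I_n} | #|A| == m} * 'S_m * {ffun 'I_m -> Cp p})%type.
HB.instance Definition _ (n p m : nat) := Finite.on (move n p m).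

Definition chosen (n p m : nat) (mv : move n p m) : {set 'I_n} := val mv.1.1.

Definition moved_label (n p m : nat) (mv : move n p m) (k : 'I_m) : 'I_n :=
  enum_val (cast_ord (esym (eqP (valP mv.1.1))) (mv.1.2 k)).

Definition move_deck (n p m : nat) (mv : move n p m) (d : seq ('I_n * Cp p)) :
  seq ('I_n * Cp p) :=
  [seq (moved_label mv k, mv.2 k) | k <- enum 'I_m]
  ++ [seq x <- d | x.1 \notin chosen mv].

Definition step (n p m : nat) (mv : move n p m) (g : cperm n p) : cperm n p :=
  odflt g [pick h | deck h == move_deck mv (deck g)].

Fixpoint Y (n p m : nat) (mvs : nat -> move n p m) (j : nat) : cperm n p :=
  if j is i.+1 then step (mvs i) (Y mvs i) else 1%g.

Definition T (n p m : nat) (mvs : nat -> move n p m) (j : nat) : {set 'I_n} :=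
  (\bigcup_(i < j) chosen (mvs i))%SET.

Definition iid_uniform_moves (R : realType) (n p m : nat) (d : measure_display)
    (Omega : measurableType d) (P : probability Omega R)
    (xi : nat -> Omega -> move n p m) : Prop :=
  [/\ forall j x, measurable [set w | xi j w = x],
      forall j x, P [set w | xi j w = x] = (unif R [set: move n p m]%SET x)%:E
    & forall k (x : nat -> move n p m),
        P [set w | forall i, (i < k)%N -> xi i w = x i] =
        (\prod_(i < k) P [set w | xi i w = x i])%E].

(* Random times take the value None at infinity. *)
Definition first_time (E : nat -> bool) : option nat :=
  if pselect (exists j, E j) is left h then Some (ex_minn h) else None.

Definition tau_after (tau : option nat) (j : nat) : bool :=
  if tau is Some k then (j < k)%N else true.

Definition tau_cov (n p m : nat) (mvs : nat -> move n p m) : option nat :=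
  first_time (fun j => T mvs j == [set: 'I_n]%SET).

Definition tau_pred (n p m : nat) (mvs : nat -> move n p m) : option nat :=
  first_time (fun j => (n.-1 <= #|T mvs j|)%N).

Definition stopping_time (n p m : nat) (Omega : Type)
    (xi : nat -> Omega -> move n p m) (tau : Omega -> option nat) : Prop :=
  forall j, <<s [set B | exists i x,
                   (i < j)%N /\ B = [set w | xi i w = x]] >>
              [set w | ~~ tau_after (tau w) j].

Definition law (R : realType) (G : finGroupType) (d : measure_display)
    (Omega : measurableType d) (P : probability Omega R) (X : Omega -> G)
    (y : G) : R := fine (P [set w | X w = y]).

Definition strong_stationary (R : realType) (n p m : nat) (d : measure_display)
    (Omega : measurableType d) (P : probability Omega R)
    (xi : nat -> Omega -> move n p m) (tau : Omega -> option nat) : Prop :=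
  [/\ stopping_time xi tau,
      P [set w | tau w = None] = 0%E
    & forall (y : cperm n p) j,
        P ([set w | Y (xi^~ w) j = y] `&` [set w | tau w = Some j]) =
        ((U R y)%:E * P [set w | tau w = Some j])%E].

Definition optimal_sst (R : realType) (n p m : nat) (d : measure_display)
    (Omega : measurableType d) (P : probability Omega R)
    (xi : nat -> Omega -> move n p m) (tau : Omega -> option nat) : Prop :=
  strong_stationary P xi tau /\
  forall j, P [set w | tau_after (tau w) j] =
            (sep (law P (fun w => Y (xi^~ w) j)) (U R))%:E.

Definition Pj (R : realType) (n p m : nat) (d : measure_display)
    (Omega : measurableType d) (P : probability Omega R)
    (xi : nat -> Omega -> move n p m) (j u : nat) : \bar R :=
  P [set w | (n - #|T (xi^~ w) j|)%N = u].

(* Main.v *)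
(** The law of the forward walk at [x] is the law of the reversed chain at
    [x^-1]. After [j] reversed moves the deck consists of a word of touched
    labels followed by the untouched labels in increasing order with color 0.
    Left multiplication by a group element relabels and recolors moves, so the
    touched word is uniform given its length. Hence the density of the walk
    with respect to [U] at [x] is [D (ell x)], where [ell x] is the maximal
    length of such an untouched tail for [x^-1] and
    [D l = \sum_(u <= l) P(n - |T_j| = u) u! p^u] is nondecreasing in [l]; under
    [U], [P(ell >= l) = 1 / (l! p^l)] for [l <= n]. Every distance becomes a sum
    over [l]. The factorial moments of [n - |T_j|] are explicit products, tend to
    those of a Poisson variable of mean [lam c], and give by inclusion-exclusion
    [D l --> sl p c l]; dominated convergence concludes. The same uniformity given
    the sizes of the [T_i] yields the strong stationary times. *)
Require Import Defs.
From HB Require Import structures.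
From mathcomp Require Import all_boot all_order all_algebra all_fingroup.
From mathcomp Require Import all_classical all_reals all_analysis.
From mathcomp Require Import ring lra zify.
Set Implicit Arguments.
Unset Strict Implicit.
Unset Printing Implicit Defensive.
Import Order.TTheory GRing.Theory Num.Theory.
Import numFieldNormedType.Exports.
Local Open Scope ring_scope.

(** * Histories of moves *)

Section Moves.
Variables n p : nat.
Implicit Types (x y z g h : cperm n p) (d : seq ('I_n * Cp p)).

(** The density depends on one statistic because, given that [t] labels are touched, the reversed
    chain is uniform on [sorted_from t], and these sets increase with [t]. A point therefore only
    sees the histories with few enough untouched labels, and [u! p^u] is the index of
    [sorted_from (n - u)] in the group. The limits need bounds uniform in [n]. The inequality
    [v! * moment v <= up ^ v], valid for every [v], dominates [P(u) u! p^u] by [(p * up) ^ u]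
    without the alternating sum. Hence the density grows at most geometrically in [l], while the
    mass at [l] is at most [1 / l!]; this absorbs every functional of power growth, so that L^q, KL,
    chi-square and total variation all go through [cvg_functional]. The sup norm sees no mass: there
    the ratio [p * up], which tends to [r], must itself stay below 1, whence the dichotomy at
    [r = 1]. *)

Lemma size_deck g : size (deck g) = n.
Proof. by rewrite size_map size_enum_ord. Qed.

Lemma nth_deck a g (i : 'I_n) : nth a (deck g) i = (g.2 i, g.1 i).
Proof. by rewrite (nth_map i) ?size_enum_ord// nth_ord_enum. Qed.

Lemma deck_inj : injective (@deck n p).
Proof.
move=> [s u] [s' u'] e; have h i : (u i, s i) = (u' i, s' i).
  by rewrite -(nth_deck (i, 0) (s, u)) e nth_deck.
by congr pair; [apply/ffunP|apply/permP] => i; case: (h i).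
Qed.

Lemma deck_labels_uniq g : uniq (map fst (deck g)).
Proof. by rewrite -map_comp map_inj_uniq ?enum_uniq//; exact: perm_inj. Qed.

Lemma mem_deck_labels g l : l \in map fst (deck g).
Proof.
rewrite -map_comp; apply/mapP; exists (g.2^-1%g l); first by rewrite mem_enum.
by rewrite /= permKV.
Qed.

Lemma nth_label_inj k (a : 'I_n * Cp p) d : size d = k -> uniq (map fst d) ->
  injective (fun i : 'I_k => (nth a d i).1).
Proof.
move=> sd ud i j /=.
rewrite -(nth_map _ a.1 fst) ?sd ?ltn_ord// -(nth_map _ a.1 fst) ?sd ?ltn_ord//
  => e.
by apply/val_inj/eqP; rewrite -(nth_uniq a.1 _ _ ud) ?size_map ?sd ?ltn_ord// e.
Qed.

Lemma deck_surj d : uniq (map fst d) -> size d = n -> exists h, deck h = d.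
Proof.
case: d => [_ /= n0|a d' /=]; first by exists 1%g; apply: size0nil;
  rewrite size_deck.
set d := a :: d' => ud sd.
have f_inj := @nth_label_inj n a d sd ud.
exists ([ffun i : 'I_n => (nth a d i).2], perm f_inj).
apply: (@eq_from_nth _ a) => [|i]; rewrite size_deck ?sd// => i_n.
by rewrite (nth_deck a _ (Ordinal i_n))/= permE ffunE/= -surjective_pairing.
Qed.

(** Left multiplication by [x] seen on one card. It ignores positions, while a move rearranges
    positions and overwrites colors, so the two are compatible once the move is relabeled too. *)
Definition relabel x (lc : 'I_n * Cp p) : 'I_n * Cp p :=
  (x.2 lc.1, x.1 lc.1 + lc.2).

Lemma relabel_fst x d : map fst (map (relabel x) d) = map x.2 (map fst d).
Proof. by elim: d => //= lc d ->. Qed.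

Lemma filter_fst (a : pred 'I_n) d :
  map fst [seq lc <- d | a lc.1] = [seq l <- map fst d | a l].
Proof. by elim: d => //= lc d <-; case: ifP. Qed.

Lemma deck_mul x g : deck (x * g)%g = map (relabel x) (deck g).
Proof.
rewrite /deck -[RHS]map_comp; apply: eq_map => i.
by rewrite /relabel /= permM !ffunE.
Qed.

Section OneSize.
Variable m : nat.
Implicit Types (mv : move n p m) (s : seq (move n p m)).

(** The block that a move puts on top. It determines the move by [moved_inj], and every word of [m]
    distinct labels occurs by [make_move_seq], so moves can be handled as words. *)
Definition moved mv : seq ('I_n * Cp p) :=
  [seq (moved_label mv k, mv.2 k) | k <- enum 'I_m].

Lemma size_moved mv : size (moved mv) = m.
Proof. by rewrite size_map size_enum_ord. Qed.

Lemma nth_moved a mv (i : 'I_m) : nth a (moved mv) i = (moved_label mv i, mv.2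
  i).
Proof. by rewrite (nth_map i) ?size_enum_ord// nth_ord_enum. Qed.

Lemma moved_label_inj mv : injective (moved_label mv).
Proof. by move=> i j /enum_val_inj/cast_ord_inj/perm_inj. Qed.

Lemma mem_chosen mv l : (l \in chosen mv) = (l \in map fst (moved mv)).
Proof.
rewrite -map_comp; apply/idP/mapP => [lA|[k _ ->]]; last exact: enum_valP.
exists (mv.1.2^-1%g (cast_ord (eqP (valP mv.1.1)) (enum_rank_in lA l))).
  by rewrite mem_enum.
by rewrite /= /moved_label permKV cast_ordK enum_rankK_in.
Qed.

Lemma moved_labels_uniq mv : uniq (map fst (moved mv)).
Proof. by rewrite -map_comp map_inj_uniq ?enum_uniq//;
  exact: moved_label_inj. Qed.

Lemma card_chosen mv : #|chosen mv| = m.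
Proof. exact: (eqP (valP mv.1.1)). Qed.

Lemma moved_inj : injective moved.
Proof.
move=> mv mv' e.
have eA : val mv.1.1 = val mv'.1.1.
  by apply/setP => l; have := mem_chosen mv l; rewrite e -mem_chosen.
have h i : (moved_label mv i, mv.2 i) = (moved_label mv' i, mv'.2 i).
  by rewrite -(nth_moved (moved_label mv i, 0)) e nth_moved.
case: mv mv' eA h {e} => [[A u] f] [[A' u'] f'] /= /val_inj eA; subst A'.
move=> h; have -> : f = f' by apply/ffunP => i; case: (h i).
have -> // : u = u'.
by apply/permP => i; case: (h i) => /enum_val_inj/cast_ord_inj.
Qed.

Section MakeMove.
Variables (ml : 'I_m -> 'I_n) (ml_inj : injective ml) (f : {ffun 'I_m -> Cp p}).

Let A := [set ml k | k in 'I_m]%SET.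

Let cardA : #|A| == m.
Proof. by rewrite card_imset// card_ord. Qed.

Let mlA k : ml k \in A. Proof. exact: imset_f. Qed.

(** A move stores its order as a permutation of the ranks inside the enumerated subset, so the
    labels [ml k] are turned into ranks within [A]. *)
Let rk k := cast_ord (eqP cardA) (enum_rank_in (mlA k) (ml k)).

Let rk_inj : injective rk.
Proof.
move=> i j /cast_ord_inj /(congr1 enum_val).
by rewrite !enum_rankK_in// => /ml_inj.
Qed.

Lemma make_move : exists mv, moved mv = [seq (ml k, f k) | k <- enum 'I_m].
Proof.
exists (exist _ A cardA, perm rk_inj, f); apply: eq_map => k.
rewrite /moved_label /= permE; congr (_, _).
rewrite [X in enum_val X](_ : _ = enum_rank_in (mlA k) (ml k)).
  by rewrite enum_rankK_in.
by apply/val_inj.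
Qed.

End MakeMove.

Lemma make_move_seq d : size d = m -> uniq (map fst d) ->
  exists mv, moved mv = d.
Proof.
case: d => [|a d'].
  move=> /= m0 _; have f_inj : injective (fun k : 'I_m => widen_ord (leq0n n)
    (cast_ord (esym m0) k)).
    by move=> i; have := ltn_ord i; rewrite -[X in (_ < X)%N]m0.
  have [mv mvE] := make_move f_inj [ffun=> 0].
  by exists mv; apply: size0nil; rewrite size_moved -m0.
set d := a :: d' => sd ud.
have f_inj := @nth_label_inj m a d sd ud.
have [mv mvE] := make_move f_inj [ffun i : 'I_m => (nth a d i).2].
exists mv; apply: (@eq_from_nth _ a); rewrite size_moved ?sd// => i i_m.
rewrite (nth_moved _ _ (Ordinal i_m)) -(nth_moved a) mvE.
by rewrite (nth_map (Ordinal i_m)) ?size_enum_ord// nth_ord_enum ffunE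
  -surjective_pairing.
Qed.

Lemma relabel_moved_uniq x mv : uniq (map fst (map (relabel x) (moved mv))).
Proof.
by rewrite relabel_fst map_inj_uniq ?moved_labels_uniq//; exact: perm_inj.
Qed.

Lemma relabel_move_ex x mv : exists mv', moved mv' == map (relabel x) (moved
  mv).
Proof.
have [||mv' <-] := @make_move_seq (map (relabel x) (moved mv));
  last by exists mv'.
  by rewrite size_map size_moved.
exact: relabel_moved_uniq.
Qed.

(** Specified through its block: relabeling does not respect the enumeration of the chosen subset,
    so the permutation component has no simple transport. [moved_inj] makes the choice unique. *)
Definition relabel_move x mv : move n p m := xchoose (relabel_move_ex x mv).

Lemma moved_relabel x mv : moved (relabel_move x mv) = map (relabel x) (moved
  mv).
Proof. by apply/eqP; exact: (xchooseP (relabel_move_ex x mv)). Qed.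

Lemma relabel_inj x : injective (relabel x).
Proof.
move=> [l c] [l' c'] e; have /= /perm_inj el := congr1 fst e.
have /= := congr1 snd e; rewrite el => ec; congr (_, _).
exact: (addrI (x.1 l')) ec.
Qed.

Lemma relabel_move_inj x : injective (relabel_move x).
Proof.
move=> mv mv' /(congr1 moved); rewrite !moved_relabel => e.
apply: moved_inj; apply: inj_map e; exact: relabel_inj.
Qed.

Lemma chosen_relabel x mv l : (x.2 l \in chosen (relabel_move x mv)) = (l \in
  chosen mv).
Proof.
by rewrite !mem_chosen moved_relabel relabel_fst mem_map//; exact: perm_inj.
Qed.

(** A [move_deck] of a deck lists every label exactly once, hence is itself a deck; the fallback of
    [step] to its default is never taken. *)
Lemma deck_step mv g : deck (step mv g) = move_deck mv (deck g).
Proof.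
rewrite /step; case: pickP => [h /eqP//|noh]; exfalso.
have ud : uniq (map fst (move_deck mv (deck g))).
  rewrite map_cat cat_uniq moved_labels_uniq/= (filter_fst (fun l => l \notin
    chosen mv)) filter_uniq ?deck_labels_uniq//.
  rewrite andbT; apply/hasPn => l; rewrite mem_filter => /andP[].
  by rewrite mem_chosen.
have [|h /eqP] := @deck_surj (move_deck mv (deck g)) ud; last by rewrite noh.
rewrite -(size_map fst) -(card_uniqP ud).
have -> : #|map fst (move_deck mv (deck g))| = #|'I_n|.
  apply: eq_card => l; rewrite map_cat mem_cat -mem_chosen (filter_fst (fun l
    => l \notin chosen mv)).
  by rewrite mem_filter mem_deck_labels andbT; case: (l \in chosen mv).
exact: card_ord.
Qed.

(** Equivariance of the chain under left multiplication, the source of all uniformity statements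
    below. *)
Lemma step_relabel x mv g : step (relabel_move x mv) (x * g)%g = (x * step mv
  g)%g.
Proof.
apply: deck_inj; rewrite deck_mul !deck_step deck_mul /move_deck map_cat.
rewrite -[[seq _ | _ <- enum 'I_m]]/(moved _) moved_relabel; congr (_ ++ _).
by rewrite filter_map; congr map; apply: eq_filter => lc /=;
  rewrite chosen_relabel.
Qed.

(* Histories list the moves with the most recent one first. *)
Definition run s : cperm n p := foldr (fun mv g => step mv g) 1%g s.

Definition touched s : {set 'I_n} := (\bigcup_(mv <- s) chosen mv)%SET.

Fixpoint top_word s : seq ('I_n * Cp p) :=
  if s is mv :: s' then moved mv ++ [seq lc <- top_word s' | lc.1 \notin chosen
    mv]
  else [::].

Definition untouched (A : {set 'I_n}) : seq ('I_n * Cp p) :=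
  [seq (l, 0) | l <- enum 'I_n & l \notin A].

(** A move filters its labels out of both parts of the deck, and filtering keeps the increasing
    order and the color 0 that the other labels have had since the identity. *)
Lemma deck_run s : deck (run s) = top_word s ++ untouched (touched s).
Proof.
elim: s => [|mv s IH] /=.
  rewrite /touched big_nil /untouched (eq_filter (a2 := predT)) ?filter_predT.
    by apply: eq_map => i; rewrite perm1 ffunE.
  by move=> l; rewrite finset.inE.
rewrite deck_step IH /move_deck filter_cat -catA; congr (_ ++ (_ ++ _)).
rewrite /untouched /touched big_cons filter_map -filter_predI; congr map.
by apply: eq_filter => l; rewrite /= finset.inE negb_or.
Qed.

Lemma top_word_labels s l : (l \in map fst (top_word s)) = (l \in touched s).
Proof.
elim: s => [|mv s IH] /=; rewrite /touched ?big_nil ?finset.inE// big_cons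
  finset.inE.
rewrite map_cat mem_cat -mem_chosen (filter_fst (fun l => l \notin chosen mv))
  mem_filter IH.
by case: (l \in chosen mv).
Qed.

Lemma top_word_uniq s : uniq (map fst (top_word s)).
Proof.
elim: s => //= mv s IH.
rewrite map_cat cat_uniq moved_labels_uniq/= (filter_fst (fun l => l \notin
  chosen mv)) filter_uniq// andbT.
by apply/hasPn => l; rewrite mem_filter mem_chosen => /andP[].
Qed.

Lemma size_top_word s : size (top_word s) = #|touched s|.
Proof.
by rewrite -(size_map fst) -(card_uniqP (top_word_uniq s));
  apply: eq_card => l; rewrite top_word_labels.
Qed.

Lemma top_word_relabel x s : top_word (map (relabel_move x) s) = map (relabel
  x) (top_word s).
Proof.
elim: s => //= mv s ->; rewrite moved_relabel map_cat filter_map;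
  congr (_ ++ map _ _).
by apply: eq_filter => lc /=; rewrite chosen_relabel.
Qed.

Lemma card_touched_relabel x s : #|touched (map (relabel_move x) s)| =
  #|touched s|.
Proof. by rewrite -!size_top_word top_word_relabel size_map. Qed.

End OneSize.

(** The elements whose deck, from position [t] on, has increasing labels of color 0
    ([mem_sorted_from]). By [run_eq] the chain lies there when [t] labels are touched. *)
Definition sorted_from t : {set cperm n p} := [set y : cperm n p | y^-1%g \in
  top_set n p t]%SET.

Definition tail_sorted d :=
  sorted ltn (map (fun lc => val lc.1) d) && all (fun lc : 'I_n * Cp p => lc.2
    == 0) d.

Lemma mem_sorted_fromP t y : reflect
  ((forall i j : 'I_n, (t <= i)%N -> (i < j)%N -> (y.2 i < y.2 j)%N) /\
   (forall j : 'I_n, (t <= j)%N -> y.1 j = 0)) (y \in sorted_from t).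
Proof.
rewrite !finset.inE; have e2 : (y^-1%g).2^-1%g = y.2 by exact: invgK.
have e1 j : (y^-1%g).1 (y.2 j) = - y.1 j by rewrite !ffunE permK.
rewrite e2; apply: (iffP andP) => -[h1 h2]; split.
- by move=> i j ti ij; have /forallP/(_ i)/forallP/(_ j) := h1; rewrite ti ij.
- move=> j tj; have /forallP/(_ j) := h2; rewrite tj e1 => /eqP e.
  by rewrite -[LHS]opprK e oppr0.
- by apply/forallP => i; apply/forallP => j; apply/implyP => /andP[]; exact: h1.
- by apply/forallP => j; apply/implyP => tj; rewrite e1 h2// oppr0.
Qed.

Lemma mem_sorted_from t y : (y \in sorted_from t) = tail_sorted (drop t (deck
  y)).
Proof.
have szd : size (drop t (deck y)) = (n - t)%N by rewrite size_drop size_deck.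
apply/mem_sorted_fromP/andP => -[h1 h2].
  split.
    rewrite (sorted_pairwise ltn_trans) pairwise_map.
    case dE : (drop t (deck y)) => [//|a d]; rewrite -dE; apply/(pairwiseP a).
    move=> i j; rewrite !inE szd => it jt ij; rewrite !nth_drop.
    have itn : (t + i < n)%N by lia.
    have jtn : (t + j < n)%N by lia.
    rewrite (nth_deck _ _ (Ordinal itn)) (nth_deck _ _ (Ordinal jtn))/=.
    by apply: h1 => /=; lia.
  case dE : (drop t (deck y)) => [//|a d]; rewrite -dE; apply/(all_nthP a).
  move=> i; rewrite szd nth_drop => it; have itn : (t + i < n)%N by lia.
  by rewrite (nth_deck _ _ (Ordinal itn))/= h2//= leq_addr.
have hnth (i : 'I_n) : (t <= i)%N -> forall a, nth a (drop t (deck y)) (i - t)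
  = (y.2 i, y.1 i).
  by move=> ti a; rewrite nth_drop subnKC// nth_deck.
split=> [i j ti ij|j tj].
  have tj : (t <= j)%N by apply: leq_trans ti (ltnW ij).
  move: h1; rewrite (sorted_pairwise ltn_trans) pairwise_map => /(pairwiseP
    (y.2 i, y.1 i)).
  move=> /(_ (i - t)%N (j - t)%N); rewrite /= !hnth//= !inE szd.
  by apply; have := ltn_ord i; have := ltn_ord j; lia.
move/(all_nthP (y.2 j, y.1 j))/(_ (j - t)%N) : h2.
by rewrite hnth// szd => /(_ _)/eqP; apply; have := ltn_ord j; lia.
Qed.

Lemma untouched_sorted A : tail_sorted (untouched A).
Proof.
apply/andP; split; last by apply/allP => lc /mapP[l _ ->].
rewrite -map_comp (eq_map (g := val))// sorted_map.
apply: sorted_filter; first by move=> i j k /=; exact: ltn_trans.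
by rewrite -sorted_map val_enum_ord iota_ltn_sorted.
Qed.

Lemma tail_sorted_inj d d' : tail_sorted d -> tail_sorted d' ->
  map fst d =i map fst d' -> d = d'.
Proof.
move=> /andP[s1 z1] /andP[s2 z2] e.
have hz (e0 : seq ('I_n * Cp p)) : all (fun lc => lc.2 == 0) e0 -> e0 = [seq
  (l, 0) | l <- map fst e0].
  move=> h; rewrite -map_comp -[LHS]map_id; apply/eq_in_map => lc /(allP h)/eqP.
  by case: lc => l c /= ->.
rewrite (hz _ z1) (hz _ z2); congr map; apply: (inj_map val_inj).
apply: (irr_sorted_eq ltn_trans ltnn); [by rewrite -[map val _]map_comp..|].
move=> k; apply/mapP/mapP => -[l ll ->]; exists l => //; first by rewrite -e.
by rewrite e.
Qed.

(** The untouched tail carries no information: its labels are those missing from [top_word s], and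
    [tail_sorted_inj] forces their order and colors. Once [y] has a sorted tail, reaching it
    constrains the top word alone. *)
Lemma run_eq m (s : seq (move n p m)) y : (run s == y) =
  (y \in sorted_from #|touched s|) && (top_word s == take #|touched s| (deck
    y)).
Proof.
rewrite mem_sorted_from -size_top_word; apply/eqP/andP => [<-|[ys /eqP wE]].
  by rewrite deck_run drop_size_cat// take_size_cat// untouched_sorted.
apply: deck_inj; rewrite deck_run -[RHS](cat_take_drop (size (top_word s))) -wE.
congr (_ ++ _); apply: tail_sorted_inj => //; first exact: untouched_sorted.
move=> l; have := mem_deck_labels y l; have := deck_labels_uniq y.
rewrite -(cat_take_drop (size (top_word s)) (deck y)) -wE map_cat cat_uniq
  mem_cat.
move=> /and3P[_ /hasPn ul _].
rewrite -map_comp map_id mem_filter mem_enum andbT -top_word_labels.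
rewrite drop_size_cat//; case: (boolP (l \in map fst (top_word s))) => /= [lt
  _|_ ->] //.
by apply/esym/negbTE/negP => /ul; rewrite /= lt.
Qed.

Lemma sorted_from_subset t t' : (t <= t')%N -> (sorted_from t \subset
  sorted_from t').
Proof.
move=> tt'; apply/fintype.subsetP => y /mem_sorted_fromP[h1 h2];
  apply/mem_sorted_fromP; split => [i j|j] t'i.
  by apply: h1; lia.
by apply: h2; lia.
Qed.

Lemma mem_sorted_from_full y : y \in sorted_from n.
Proof. by rewrite mem_sorted_from drop_oversize ?size_deck. Qed.

(* Left multiplication by [y' * y^-1] carries [y] to [y']; lifted to moves it
   injects the histories ending in [y] into those ending in [y']. *)
Lemma card_history_le m j t y y' (E : pred (seq (move n p m))) :
  (forall x s, E (map (relabel_move x) s) = E s) -> y \in sorted_from t -> y'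
    \in sorted_from t ->
  (#|[set s : j.-tuple (move n p m) | [&& run s == y, #|touched s| == t & E
    s]]%SET|
   <= #|[set s : j.-tuple (move n p m) | [&& run s == y', #|touched s| == t & E
     s]]%SET|)%N.
Proof.
move=> hE Wy Wy'; pose x := (y' * y^-1)%g.
have inj : injective (map_tuple (relabel_move x) : j.-tuple _ -> j.-tuple (move
  n p m)).
  move=> s s' /(congr1 val) /= e; apply: val_inj; apply: inj_map e.
  exact: relabel_move_inj.
rewrite -(card_imset _ inj); apply: subset_leq_card;
  apply/fintype.subsetP => s'.
move=> /imsetP[s]; rewrite finset.inE => /and3P[ys /eqP ts Es] ->.
rewrite finset.inE /= card_touched_relabel ts eqxx hE Es !andbT.
move: ys; rewrite !run_eq card_touched_relabel ts Wy Wy' top_word_relabel /= =>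
  /eqP ->.
by rewrite map_take -deck_mul /x mulgKV.
Qed.

(** [card_history_le] in both directions makes the count the same for all [y] in [sorted_from t].
    The invariant event [E] allows the earlier sizes of the touched set to be prescribed too, as the
    stopping times require. *)
Lemma card_history m j t y (E : pred (seq (move n p m))) :
  (forall x s, E (map (relabel_move x) s) = E s) ->
  (#|[set s : j.-tuple (move n p m) | [&& run s == y, #|touched s| == t & E
    s]]%SET| * #|sorted_from t|
   = (y \in sorted_from t) * #|[set s : j.-tuple (move n p m) | (#|touched s|
     == t) && E s]%SET|)%N.
Proof.
move=> hE; case: (boolP (y \in sorted_from t)) => Wy; last first.
  rewrite mul0n [X in (X * _)%N](_ : _ = 0%N)//; apply/eqP; rewrite cards_eq0.
  apply/eqP/setP => s; rewrite !finset.inE; apply/negbTE/negP => /and3P[+ /eqP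
    ts _].
  by rewrite run_eq ts (negbTE Wy).
rewrite mul1n [RHS](_ : _ = \sum_(z in sorted_from t)
   #|[set s : j.-tuple (move n p m) | [&& run s == z, #|touched s| == t & E
     s]]%SET|)%N.
  rewrite mulnC -sum_nat_const; apply: eq_bigr => z Wz.
  by apply/eqP; rewrite eqn_leq !card_history_le.
rewrite -sum1_card (partition_big (fun s : j.-tuple _ => run s) (fun z => z \in
  sorted_from t))/=.
  apply: eq_bigr => z Wz; rewrite -sum1_card; apply: eq_bigl => s.
  by rewrite !finset.inE andbC.
move=> s; rewrite finset.inE => /andP[/eqP <- _].
by have := eqxx (run s); rewrite {1}run_eq => /andP[].
Qed.

(** A move of size [t] from the identity touches exactly [t] labels, and its block has to be the
    first [t] cards of [z]. The size [t] is independent of the step size of the walk, so that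
    [card_sorted_from_move] counts [sorted_from t] for every [t <= n]. *)
Lemma card_step_one t (z : cperm n p) : (t <= n)%N ->
  #|[set mv : move n p t | step mv 1%g == z]%SET| = (z \in sorted_from t).
Proof.
move=> tn; have hz (mv : move n p t) :
    (step mv 1%g == z) = (z \in sorted_from t) && (moved mv == take t (deck z)).
  have := run_eq [:: mv] z; rewrite /run /= cats0 => ->.
  by rewrite /touched big_seq1 card_chosen.
case: (boolP (z \in sorted_from t)) => Wz; last first.
  by apply/eqP; rewrite cards_eq0; apply/eqP/setP => mv;
    rewrite !finset.inE hz (negbTE Wz).
have [||mv mvE] := @make_move_seq t (take t (deck z)).
- by rewrite size_takel// size_deck.
- by rewrite map_take take_uniq// deck_labels_uniq.
apply/eqP/cards1P; exists mv; apply/setP => mv'.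
by rewrite !finset.inE hz Wz -mvE (inj_eq (@moved_inj t)).
Qed.

Lemma card_sorted_from_move t : (t <= n)%N -> #|sorted_from t| = #|{: move n p
  t}|.
Proof.
move=> tn; rewrite -[RHS]sum1_card (partition_big (fun mv : move n p t => step
  mv 1%g) predT)//=.
rewrite -sum1_card [LHS]big_mkcond/=; apply: eq_bigr => z _.
by rewrite sum1dep_card card_step_one//; case: (_ \in _).
Qed.

End Moves.

(** * Cardinalities and one-step transition counts *)

Section Cards.
Variables n p : nat.
Implicit Types (x y z g h : cperm n p).

Lemma card_move t : #|{: move n p t}| = (n ^_ t * p.-1.+1 ^ t)%N.
Proof.
rewrite !card_prod card_ffun card_Sn !card_ord -bin_ffact.
congr (_ * _ * _)%N; rewrite card_sig -[X in 'C(X, t)]card_ord -card_draws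
  cardsE.
by apply: eq_card => A; rewrite !inE.
Qed.

Lemma card_cperm : #|{: cperm n p}| = (n`! * p.-1.+1 ^ n)%N.
Proof. by rewrite card_prod card_ffun card_Sn !card_ord mulnC. Qed.

Lemma card_sorted_from t : (t <= n)%N -> (#|sorted_from n p t| * ((n - t)`! *
  p.-1.+1 ^ (n - t)) = #|{: cperm n p}|)%N.
Proof.
move=> tn; rewrite card_sorted_from_move// card_move card_cperm mulnACA
  ffact_fact//.
by rewrite -expnD subnKC.
Qed.

Lemma card_step m g h : (m <= n)%N ->
  #|[set mv : move n p m | step mv g == h]%SET| = ((g^-1 * h)%g \in sorted_from
    n p m).
Proof.
move=> mn; rewrite -(card_step_one (g^-1 * h)%g mn); apply/eqP;
  rewrite eqn_leq; apply/andP; split.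
- rewrite -[leqLHS](card_imset _ (@relabel_move_inj n p m g^-1%g));
  apply: subset_leq_card.
  apply/fintype.subsetP => mv' /imsetP[mv]; rewrite !finset.inE => /eqP <- ->.
  by rewrite -(mulVg g) step_relabel.
- rewrite -[leqLHS](card_imset _ (@relabel_move_inj n p m g));
  apply: subset_leq_card.
  apply/fintype.subsetP => mv' /imsetP[mv]; rewrite !finset.inE => /eqP e ->.
  by rewrite -[X in step _ X]mulg1 step_relabel e mulKVg.
Qed.

End Cards.

Lemma sum_tupleS (V : nmodType) (M : finType) j (F : seq M -> V) :
  \sum_(s : j.+1.-tuple M) F s = \sum_(s : j.-tuple M) \sum_(x : M) F (x :: s).
Proof.
rewrite exchange_big pair_big/=.
rewrite (reindex (fun u : M * j.-tuple M => [tuple of u.1 :: u.2]))//=.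
exists (fun s : j.+1.-tuple M => (thead s, [tuple of behead s])).
  by move=> [x s] _ /=; congr (_, _); apply: val_inj.
by move=> s _; rewrite [s in RHS]tuple_eta; apply: val_inj.
Qed.

(** [convpow] adds its factors on the right. Inversion reverses products, so the latest move of the
    reversed chain is the leftmost factor, and the recursion is needed on that side. *)
Lemma convpowS (R : realType) (G : finGroupType) (M : G -> R) k z : convpow M
  k.+1 z = Defs.conv M (convpow M k) z.
Proof.
elim: k z => [|k IH] z.
  rewrite /convpow /= /Defs.conv (bigD1 z)//= [RHS](bigD1 1%g)//= !mulgV !eqxx.
  rewrite invg1 mulg1 mul1r mulr1 !big1 ?addr0// => u u1.
    by rewrite (negbTE u1) mulr0.
  by rewrite -eq_mulgV1 eq_sym (negbTE u1) mul0r.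
have -> : convpow M k.+2 z = Defs.conv (convpow M k.+1) M z by [].
rewrite [RHS](_ : _ = \sum_u M (z * u^-1)%g * Defs.conv (convpow M k) M u)//.
rewrite /Defs.conv; under eq_bigr do rewrite IH /Defs.conv big_distrl/=.
under [RHS]eq_bigr do rewrite /Defs.conv big_distrr/=.
rewrite [RHS]exchange_big/=; apply: eq_bigr => u _.
rewrite [RHS](reindex_inj (mulIg u))/=; apply: eq_bigr => v _.
by rewrite mulgK invMg !mulgA mulrA.
Qed.

(** * The law of the walk as a proportion of histories *)

Section Law.
Variables (R : realType) (n p m : nat).
Hypothesis mn : (m <= n)%N.

(** The uniform probability on histories of length [j]; measure theory only enters with
    [prob_hist]. *)
Definition hist_prob j (E : pred (seq (move n p m))) : R :=
  #|[set s : j.-tuple (move n p m) | E s]%SET|%:R / #|{: move n p m}|%:R ^+ j.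

Lemma card_move_gt0 : (0 < #|{: move n p m}|)%N.
Proof. by rewrite card_move muln_gt0 ffact_gt0 mn expn_gt0. Qed.

Lemma card_histE j (E : pred (seq (move n p m))) :
  #|[set s : j.-tuple (move n p m) | E s]%SET|%:R = \sum_(s : j.-tuple (move n
    p m)) (E s)%:R :> R.
Proof.
rewrite -sum1_card natr_sum big_mkcond/=; apply: eq_bigr => s _.
by rewrite finset.inE; case: (E s).
Qed.

Lemma hist_probS j (E : pred (seq (move n p m))) :
  hist_prob j.+1 E = #|{: move n p m}|%:R^-1 * \sum_(mv : move n p m) hist_prob
    j (fun s => E (mv :: s)).
Proof.
rewrite /hist_prob -mulr_suml mulrCA exprS invfM; congr (_ * _).
rewrite card_histE (sum_tupleS j (fun s => (E s)%:R)) exchange_big/=.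
by apply: eq_bigr => mv _; rewrite (card_histE j (fun s => E (mv :: s))).
Qed.

Lemma eq_hist_prob j (E E' : pred (seq (move n p m))) :
  (forall s, size s = j -> E s = E' s) -> hist_prob j E = hist_prob j E'.
Proof.
move=> e; congr (_%:R / _); apply: eq_card => s.
by rewrite !finset.inE e// size_tuple.
Qed.

Lemma mem_top_set_V t y : (y \in top_set n p t) = (y^-1%g \in sorted_from n p
  t).
Proof. by rewrite /sorted_from [in RHS]finset.inE invgK. Qed.

Lemma card_top_set t : #|top_set n p t| = #|sorted_from n p t|.
Proof.
rewrite -[LHS](card_imset _ (@invg_inj _)); apply: eq_card => y.
apply/imsetP/idP => [[x xt ->]|yt]; first by rewrite -mem_top_set_V.
by exists y^-1%g; rewrite ?invgK// mem_top_set_V invgK.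
Qed.

Lemma hist_prob_partition (I : finType) (f : seq (move n p m) -> I) j (E : pred
  (seq (move n p m))) :
  hist_prob j E = \sum_(i : I) hist_prob j (fun s => (f s == i) && E s).
Proof.
rewrite /hist_prob -mulr_suml -natr_sum; congr (_%:R / _).
rewrite -sum1_card (partition_big (fun s : j.-tuple _ => f s) predT)//=.
apply: eq_bigr => i _; rewrite -sum1_card; apply: eq_bigl => s.
by rewrite !finset.inE andbC.
Qed.

Lemma hist_prob_andb j (E : pred (seq (move n p m))) (b : bool) :
  hist_prob j (fun s => E s && b) = hist_prob j E * b%:R.
Proof.
case: b; rewrite ?mulr1 ?mulr0; first by apply: eq_hist_prob => s _;
  rewrite andbT.
rewrite /hist_prob [X in X%:R](_ : _ = 0%N) ?mul0r//; apply/eqP;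
  rewrite cards_eq0.
by apply/eqP/setP => s; rewrite !finset.inE andbF.
Qed.

Lemma convpow_hist_prob j z :
  convpow (Q R n p m) j z = hist_prob j (fun s => run s == z^-1%g).
Proof.
elim: j z => [|j IH] z.
  rewrite /convpow /= /hist_prob expr0 divr1; congr (_%:R).
  have -> : (z == 1%g) = (@run n p m [::] == z^-1%g) by rewrite /=
    -[RHS](inj_eq invg_inj) invgK invg1 eq_sym.
  case: (boolP (@run n p m [::] == z^-1%g)) => h.
    apply/esym/eqP/cards1P; exists [tuple]; apply/setP => s.
    by rewrite !finset.inE (tuple0 s) eqxx.
  apply/esym/eqP; rewrite cards_eq0; apply/eqP/setP => s.
  by rewrite !finset.inE (tuple0 s) (negbTE h).
rewrite convpowS /Defs.conv; under eq_bigr do rewrite IH.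
rewrite hist_probS; under [in RHS]eq_bigr => mv _.
  rewrite (hist_prob_partition (@run n p m)).
  under eq_bigr => g _.
    rewrite (@eq_hist_prob _ _ (fun s => (run s == g) && (step mv g ==
      z^-1%g))); last first.
      by move=> s _ /=; case: (run s =P g) => [->|].
    rewrite hist_prob_andb; over.
  over.
rewrite exchange_big/= mulr_sumr (reindex_inj invg_inj)/=;
  apply: eq_bigr => g _.
(* [Q] is constant on a set with as many elements as there are moves, and each allowed transition is
   realized by exactly one move. *)
rewrite -mulr_sumr invgK /Q /unif card_top_set [LHS]mulrC [RHS]mulrCA.
congr (_ * _); rewrite mulrC card_sorted_from_move//; congr (_ * _).
rewrite -natr_sum -big_mkcond/= sum1dep_card card_step//.
by rewrite mem_top_set_V invMg.
Qed.

Lemma touched_le (s : seq (move n p m)) : (#|touched s| <= n)%N.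
Proof. by rewrite -[leqRHS]card_ord; exact: max_card. Qed.

Lemma hist_prob_run_touched j t y (E : pred (seq (move n p m))) : (t <= n)%N ->
  (forall x s, E (map (relabel_move x) s) = E s) ->
  hist_prob j (fun s => [&& run s == y, #|touched s| == t & E s]) =
  (y \in sorted_from n p t)%:R / #|sorted_from n p t|%:R * hist_prob j (fun s
    => (#|touched s| == t) && E s).
Proof.
move=> tn hE; have := card_history j t y hE; rewrite /hist_prob mulrA => e.
congr (_ / _); apply/eqP; rewrite mulrAC eq_sym.
have W0 : #|sorted_from n p t|%:R != 0 :> R.
  by rewrite card_sorted_from_move// pnatr_eq0 -lt0n card_move muln_gt0
    ffact_gt0 tn expn_gt0.
by rewrite (can2_eq (mulfVK W0) (mulfK W0)) -!natrM e.
Qed.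

(* The paper's [P_j^(m)(u)], as a proportion of histories. *)
Definition untouched_prob j u : R := hist_prob j (fun s => (n - #|touched s|)%N
  == u).

(* The value of the density of the walk on [ell = l], see [convpow_density]. *)
Definition density j l : R := \sum_(u < l.+1) untouched_prob j u * (u`!%:R *
  p.-1.+1%:R ^+ u).

Lemma untouched_prob_ge0 j u : 0 <= untouched_prob j u.
Proof. by rewrite /untouched_prob /hist_prob. Qed.

Lemma untouched_prob_gt j u : (n < u)%N -> untouched_prob j u = 0.
Proof.
move=> nu; rewrite /untouched_prob /hist_prob [X in X%:R](_ : _ = 0%N)
  ?mul0r//; apply/eqP; rewrite cards_eq0.
by apply/eqP/setP => s; rewrite !finset.inE; lia.
Qed.

Lemma density_nondecreasing j l l' : (l <= l')%N -> density j l <= density j l'.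
Proof.
move=> ll'; rewrite /density -!(big_mkord predT (fun u => untouched_prob j u *
  (u`!%:R * p.-1.+1%:R ^+ u))).
rewrite (@big_cat_nat _ _ _ l.+1 0 l'.+1)//= lerDl sumr_ge0// => u _.
by rewrite mulr_ge0 ?untouched_prob_ge0// mulr_ge0.
Qed.

Definition ell (x : cperm n p) : nat := \max_(u < n.+1 | x \in top_set n p (n -
  u)) u.

Lemma ell_le x : (ell x <= n)%N.
Proof. by apply/bigmax_leqP => u _; rewrite -ltnS. Qed.

(** [sorted_from] grows with the cut position, so the admissible tail lengths form an initial
    segment, which its maximum determines. *)
Lemma top_set_ell x u : (u <= n)%N -> (x \in top_set n p (n - u)) = (u <= ell
  x)%N.
Proof.
move=> un; apply/idP/idP => [xu|].
  have := @leq_bigmax_cond _ (fun u : 'I_n.+1 => x \in top_set n p (n - u))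
    (@nat_of_ord _) (@Ordinal n.+1 u un).
  by apply.
rewrite /ell; have [|i xi ->] := @eq_bigmax_cond _ (fun u : 'I_n.+1 => x \in
  top_set n p (n - u)) (@nat_of_ord _).
  by apply/card_gt0P; exists ord0; suff : x \in top_set n p (n - 0) by [];
    rewrite subn0 mem_top_set_V mem_sorted_from_full.
have {xi} : x \in top_set n p (n - i) := xi; move=> xi ui; move: xi.
rewrite !mem_top_set_V; apply/fintype.subsetP/sorted_from_subset.
by apply: leq_sub2l.
Qed.

Lemma UE (x : cperm n p) : U R x = #|{: cperm n p}|%:R^-1.
Proof. by rewrite /U /unif finset.inE cardsT mul1r. Qed.

(** Only histories with [u <= ell x] untouched labels can reach [x^-1]. Each such [u] contributes
    its probability divided by [#|sorted_from (n - u)|], and dividing by [U x] leaves the factor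
    [u! p^u]. *)
Lemma convpow_density j x :
  convpow (Q R n p m) j x / U R x = density j (ell x).
Proof.
rewrite convpow_hist_prob (hist_prob_partition (fun s => inord (n - #|touched
  s|)%N : 'I_n.+1)).
rewrite mulr_suml /density (big_ord_widen _ (fun u => untouched_prob j u *
  (u`!%:R * p.-1.+1%:R ^+ u)) (ell_le x : _ < n.+1)%N).
rewrite [RHS]big_mkcond; apply: eq_bigr => u _.
have un : (u <= n)%N by rewrite -ltnS.
rewrite (@eq_hist_prob _ _ (fun s => [&& run s == x^-1%g, #|touched s| == (n -
  u)%N & predT s])); last first.
  move=> s _; rewrite andbT andbC; congr (_ && _); have := touched_le s.
  rewrite -val_eqE /= inordK ?ltnS ?leq_subr//; lia.
rewrite hist_prob_run_touched ?leq_subr// -mem_top_set_V top_set_ell//.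
rewrite (@eq_hist_prob _ _ (fun s => (n - #|touched s|)%N == u)); last first.
  by move=> s _; rewrite andbT; have := touched_le s; lia.
rewrite ltnS; case: leqP => _; last by rewrite !mul0r.
rewrite mul1r UE invrK -mulrA mulrCA; congr (_ * _).
have W0 : #|sorted_from n p (n - u)|%:R != 0 :> R.
  by rewrite card_sorted_from_move ?leq_subr// pnatr_eq0 -lt0n card_move
    muln_gt0 ffact_gt0 leq_subr expn_gt0.
apply: (mulfI W0); rewrite mulVKf// -(card_sorted_from p (leq_subr u n))
  subKn//.
by rewrite !natrM natrX.
Qed.

End Law.

(** * The density as a function of the sorted tail *)

Section Functionals.
Variables (R : realType) (n p m : nat).
Hypotheses (mn : (m <= n)%N) (hp : (0 < p)%N).
Implicit Types (x : cperm n p) (F : R -> R).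

(* Under [U], [ell >= l] has probability [ell_tail l] and [ell = l] has
   probability [ell_mass l]; see [sum_ell_ge] and [sum_ell_eq]. *)
Definition ell_tail (l : nat) : R := (l`!%:R * p%:R ^+ l)^-1.

Lemma alE l : al R p l = ell_tail l - ell_tail l.+1. Proof. by []. Qed.

Lemma ell_tail_gt0 l : 0 < ell_tail l.
Proof. by rewrite invr_gt0 mulr_gt0 ?exprn_gt0 ?ltr0n ?fact_gt0. Qed.

Lemma ell_tail_nincr l : ell_tail l.+1 <= ell_tail l.
Proof.
rewrite lef_pV2 ?posrE ?mulr_gt0 ?exprn_gt0 ?ltr0n ?fact_gt0//.
by rewrite ler_pM ?exprn_ge0 ?ler_nat ?leq_fact// exprS ler_peMl ?exprn_ge0//
  ler1n.
Qed.

Lemma al_ge0 l : 0 <= al R p l.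
Proof. by rewrite alE subr_ge0 ell_tail_nincr. Qed.

Definition ell_mass l : R := ell_tail l - (l < n)%:R * ell_tail l.+1.

(** No tail is longer than [n], so in the range [l <= n] the mass differs from the limiting weight
    [al] only at [l = n]. *)
Lemma ell_mass_lt l : (l < n)%N -> ell_mass l = al R p l.
Proof. by move=> ln; rewrite /ell_mass ln mul1r. Qed.

Lemma ell_mass_ge0 l : 0 <= ell_mass l.
Proof.
rewrite /ell_mass; case: ltnP => _; rewrite ?mul1r ?mul0r ?subr0 ?(ltW
  (ell_tail_gt0 _))//.
by rewrite subr_ge0 ell_tail_nincr.
Qed.

Lemma ell_mass_le l : ell_mass l <= ell_tail l.
Proof. by rewrite /ell_mass gerBl mulr_ge0// ltW ?ell_tail_gt0. Qed.

Lemma sum_ell_ge u : (u <= n)%N ->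
  \sum_(x : cperm n p) (u <= ell x)%:R * U R x = ell_tail u.
Proof.
move=> un; under eq_bigr => x _ do rewrite UE -(top_set_ell _ un).
rewrite -mulr_suml -natr_sum -big_mkcond/= sum1_card card_top_set.
have := card_sorted_from p (leq_subr u n); rewrite subKn// => <-.
rewrite natrM invfM mulrA mulfV ?mul1r ?natrM ?natrX ?prednK//.
by rewrite card_sorted_from_move ?leq_subr// pnatr_eq0 -lt0n card_move muln_gt0
  ffact_gt0 leq_subr expn_gt0.
Qed.

Lemma avg_ell (f : nat -> R) :
  \sum_(x : cperm n p) f (ell x) * U R x = \sum_(l < n.+1) ell_mass l * f l.
Proof.
have wE (l : 'I_n.+1) : ell_mass l = \sum_(x : cperm n p) (ell x == l)%:R * U R
  x.
  have ln : (l <= n)%N by rewrite -ltnS.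
  rewrite /ell_mass -(sum_ell_ge ln); case: ltnP => h.
    rewrite mul1r -(sum_ell_ge h) -sumrB; apply: eq_bigr => x _.
    rewrite -mulrBl; congr (_ * _); rewrite eqn_leq.
    by case: (ltngtP (ell x) l) => //; rewrite ?subrr ?subr0.
  rewrite mul0r subr0; apply: eq_bigr => x _; rewrite eqn_leq.
  by rewrite (leq_trans (ell_le x) h).
under [RHS]eq_bigr => l _ do rewrite wE mulr_suml.
rewrite exchange_big; apply: eq_bigr => x _ /=.
rewrite (bigD1 (Ordinal (ell_le x : ell x < n.+1)%N))//= eqxx mul1r mulrC.
rewrite big1 ?addr0// => l; rewrite -val_eqE/= eq_sym => /negbTE ->.
by rewrite !mul0r.
Qed.

Lemma U_gt0 x : 0 < U R x.
Proof. by rewrite UE invr_gt0 ltr0n; apply/card_gt0P; exists x. Qed.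

Variable j : nat.
Local Notation M := (convpow (Q R n p m) j).
Local Notation D := (density R n p m j).

Lemma convpowE x : M x = D (ell x) * U R x.
Proof. by rewrite -(convpow_density R mn) divfK ?gt_eqF ?U_gt0. Qed.

Lemma reldensE x : reldens M x = D (ell x) - 1.
Proof. by rewrite /reldens convpowE mulfK ?gt_eqF ?U_gt0. Qed.

Lemma hist_probT : hist_prob R j (fun _ : seq (move n p m) => true) = 1.
Proof.
rewrite /hist_prob [X in X%:R](_ : _ = #|{: j.-tuple (move n p m)}|).
  by rewrite card_tuple natrX divff// expf_neq0// pnatr_eq0 -lt0n card_move_gt0.
by apply: eq_card => s; rewrite !inE.
Qed.

Lemma sum_convpow : \sum_(x : cperm n p) M x = 1.
Proof.
under eq_bigr do rewrite convpow_hist_prob//.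
rewrite (reindex_inj invg_inj)/=; under eq_bigr do rewrite invgK.
rewrite -hist_probT (hist_prob_partition R (@run n p m)); apply: eq_bigr => x _.
by apply: eq_hist_prob => s _; rewrite andbT.
Qed.

Lemma mean_density : \sum_(l < n.+1) ell_mass l * D l = 1.
Proof. by rewrite -avg_ell -sum_convpow; apply: eq_bigr => x _;
  rewrite convpowE. Qed.

Lemma sum_U : \sum_(x : cperm n p) U R x = 1.
Proof.
under eq_bigr do rewrite UE.
rewrite sumr_const -[LHS]mulr_natl divff// pnatr_eq0 -lt0n.
by apply/card_gt0P; exists 1%g.
Qed.

Lemma sum_ell_mass : \sum_(l < n.+1) ell_mass l = 1.
Proof.
rewrite -sum_U; under eq_bigr do rewrite -[ell_mass _]mulr1.
by rewrite -(avg_ell (fun=> 1)); under eq_bigr do rewrite mul1r.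
Qed.

Lemma density_ge0 l : 0 <= D l.
Proof. by rewrite sumr_ge0// => u _; rewrite mulr_ge0 ?untouched_prob_ge0//
  mulr_ge0. Qed.

Lemma lq_normE (q : R) : 1 <= q -> lq_norm q (reldens M) `^ q =
  \sum_(l < n.+1) ell_mass l * `|D l - 1| `^ q.
Proof.
move=> q1; rewrite /lq_norm -powRrM mulVf ?gt_eqF ?(lt_le_trans ltr01)// powRr1.
  rewrite -(avg_ell (fun l => `|D l - 1| `^ q)).
  by apply: eq_bigr => x _; rewrite reldensE.
by rewrite sumr_ge0// => x _; rewrite mulr_ge0 ?powR_ge0// ltW ?U_gt0.
Qed.

Lemma chi2E : chi2 M = \sum_(l < n.+1) ell_mass l * (D l) ^+ 2 - 1.
Proof.
rewrite /chi2 -powR_mulrn ?powR_ge0// lq_normE ?ler1n//.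
transitivity (\sum_(l < n.+1) (ell_mass l * D l ^+ 2 - ell_mass l * D l *+ 2 +
  ell_mass l)).
  apply: eq_bigr => l _; rewrite powR_mulrn// real_normK ?num_real//; ring.
rewrite big_split/= sumrB sumrMnl mean_density sum_ell_mass; ring.
Qed.

Lemma KLE : KL M (U R) = \sum_(l < n.+1) ell_mass l * (D l * ln (D l)).
Proof.
rewrite -(avg_ell (fun l => D l * ln (D l))); apply: eq_bigr => x _.
by rewrite convpowE mulfK ?gt_eqF ?U_gt0// mulrAC.
Qed.

(** Half the mean of an absolute value is the mean of the positive part when the signed mean
    vanishes ([mean_density]). The positive part of [1 - D] is at most 1 and vanishes once [D >= 1],
    which in the limit produces the truncation at [wstar]. *)
Lemma tvE : tv M (U R) = \sum_(l < n.+1) ell_mass l * Num.max 0 (1 - D l).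
Proof.
have h y : `|y| = 2 * Num.max 0 y - y :> R.
  rewrite /Num.max; case: ifPn => hy; first by rewrite gtr0_norm//; ring.
  by rewrite ler0_norm ?leNgt//; ring.
rewrite /tv; transitivity (2^-1 * \sum_(l < n.+1) ell_mass l * `|1 - D l|).
  rewrite -(avg_ell (fun l => `|1 - D l|)); congr (_ * _);
    apply: eq_bigr => x _.
  rewrite convpowE -[X in `|_ - X|]mul1r -mulrBl normrM distrC.
  by rewrite (gtr0_norm (U_gt0 x)).
rewrite mulr_sumr; transitivity (\sum_(l < n.+1)
    (ell_mass l * Num.max 0 (1 - D l) - 2^-1 * (ell_mass l - ell_mass l * D
      l))).
  by apply: eq_bigr => l _; rewrite h; field.
by rewrite sumrB -mulr_sumr sumrB mean_density sum_ell_mass subrr mulr0 subr0.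
Qed.

Lemma sum_ell_eq l : (l <= n)%N ->
  \sum_(x : cperm n p) (ell x == l)%:R * U R x = ell_mass l.
Proof.
move=> ln; rewrite (avg_ell (fun k => (k == l)%:R)) (bigD1 (Ordinal (ln : l <
  n.+1)%N))//=.
rewrite eqxx mulr1 big1 ?addr0// => k; rewrite -val_eqE/= => /negbTE ->.
by rewrite mulr0.
Qed.

Hypothesis n0 : (0 < n)%N.
(** The smallest value of [ell]: with a single color a one-card tail is always sorted. *)
Let l0 := nat_of_bool (p == 1%N).

Lemma ell_mass_min_gt0 : 0 < ell_mass l0.
Proof.
rewrite /ell_mass /l0; case: eqP => p1 /=.
  case: (ltnP 1 n) => _; rewrite ?mul1r ?mul0r ?subr0 ?ell_tail_gt0//.
  by rewrite /ell_tail p1 !expr1n !mulr1 subr_gt0 ltf_pV2 ?posrE// ltr_nat.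
rewrite n0 mul1r subr_gt0 /ell_tail ltf_pV2 ?posrE ?mulr_gt0 ?exprn_gt0
  ?ltr0n//.
by rewrite !mul1r expr0 expr1 ltr1n; lia.
Qed.

(** For [p = 1] the event [ell = 0] has mass [1/0! - 1/1! = 0] under a measure that charges every
    point. *)
Lemma ell_ge x : (l0 <= ell x)%N.
Proof.
rewrite /l0; case: eqP => //= p1; rewrite lt0n; apply/eqP => ell0.
have : ell_mass 0 = 0.
  by rewrite /ell_mass /ell_tail n0 p1 !expr1n !mulr1 mul1r subrr.
rewrite -sum_ell_eq// => /eqP; rewrite psumr_eq0 => [/allP/(_ x)|y _];
  last first.
  by rewrite mulr_ge0// ltW// U_gt0.
by rewrite mem_index_enum ell0 eqxx mul1r (gt_eqF (U_gt0 _)) => /(_ isT).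
Qed.

Lemma ell_min_ex : exists x : cperm n p, ell x = l0.
Proof.
apply/not_existsP => h; have := ell_mass_min_gt0; rewrite -sum_ell_eq;
  last first.
  by rewrite /l0; case: eqP.
rewrite big1 ?ltxx// => x _; case: eqP => [/h//|_]; exact: mul0r.
Qed.

Lemma sepE : sep M (U R) = 1 - D l0.
Proof.
rewrite /sep; congr (1 - _); apply/le_anti/andP; split.
  have [x <-] := ell_min_ex.
  by rewrite -(convpow_density R mn); exact: bigmin_le_cond.
apply/bigmin_geP; split=> [|x _]; rewrite convpow_density//.
  by apply: density_nondecreasing; exact: ell_ge.
by apply: density_nondecreasing; exact: ell_ge.
Qed.

Lemma ell_one : ell (1%g : cperm n p) = n.
Proof.
apply/eqP; rewrite eqn_leq ell_le/= -top_set_ell// subnn mem_top_set_V.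
apply/mem_sorted_fromP; split=> [i k _ ik|k _]; first by rewrite invg1 !perm1.
by rewrite invg1 ffunE.
Qed.

(** The maximum could come from [D n - 1] or from [1 - D l0]. As [D] has mean 1 and [l0] carries at
    least half of the mass, the deficit at [l0] is at most the excess at the top, which the identity
    attains. *)
Lemma linf_normE : (1 < n)%N -> linf_norm (reldens M) = D n - 1.
Proof.
move=> n1; have l0n : (l0 < n)%N by rewrite (leq_ltn_trans _ n1)// /l0;
  case: eqP.
have w12 : 1 <= 2 * ell_mass l0.
  rewrite ell_mass_lt// /l0 /al; case: eqP => p1 /=.
    by rewrite p1 !expr1n !mulr1 /= -[2`!%:R]/(2%:R) -[1`!%:R]/(1%:R); lra.
  rewrite !expr1 expr0 !mul1r invr1.
  have : (p%:R : R)^-1 <= 2^-1 by rewrite lef_pV2 ?posrE ?ltr0n// ler_nat; lia.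
  lra.
have Dn l : (l < n.+1)%N -> D l <= D n by move=> ln;
  exact: density_nondecreasing.
have Dn1 : 1 <= D n.
  rewrite -mean_density -[leRHS]mul1r -sum_ell_mass mulr_suml;
    apply: ler_sum => l _.
  by rewrite ler_wpM2l ?ell_mass_ge0 ?Dn.
have D0 : 1 - D l0 <= D n - 1.
  have l0n' : (l0 < n.+1)%N by exact: ltnW.
  have := mean_density; rewrite (bigD1 (Ordinal l0n'))//=.
  have := sum_ell_mass; rewrite (bigD1 (Ordinal l0n'))//=.
  set S := \sum_(l < n.+1 | _) ell_mass l; set S' := \sum_(l < n.+1 | _) _ =>
    hS hS'.
  have : S' <= S * D n.
    by rewrite mulr_suml; apply: ler_sum => l _;
      rewrite ler_wpM2l ?ell_mass_ge0 ?Dn.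
  nra.
apply/le_anti/andP; split.
  apply/bigmax_leP; split=> [|x _]; first by rewrite subr_ge0.
  have := Dn (ell x) (ell_le x); have := density_nondecreasing R n p m j
    (ell_ge x).
  by rewrite reldensE ler_norml; lra.
have -> : D n - 1 = `|reldens M 1%g| by rewrite reldensE ell_one ger0_norm
  ?subr_ge0.
exact: le_bigmax_cond.
Qed.

End Functionals.

(** * Factorial moments of the number of untouched labels *)

Lemma cardC_ord n (A : {set 'I_n}) : #|~: A|%SET = (n - #|A|)%N.
Proof. by have := cardsC A; rewrite card_ord; lia. Qed.

Section FactorialMoments.
Variables (R : realType) (n p m : nat).
Hypothesis mn : (m <= n)%N.

Lemma card_move_avoid (B : {set 'I_n}) :
  (#|[set mv : move n p m | [disjoint B & chosen mv]]%SET| * 'C(n, m) =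
   'C(n - #|B|, m) * #|{: move n p m}|)%N.
Proof.
pose S := [set a : {A : {set 'I_n} | #|A| == m} | [disjoint B & val a]]%SET.
have -> : [set mv : move n p m | [disjoint B & chosen mv]]%SET =
    finset.setX (finset.setX S [set: 'S_m]%SET) [set: {ffun 'I_m -> Cp p}]%SET.
  by apply/setP => -[[a u] f]; rewrite !finset.inE !andbT.
have cS : #|S| = 'C(n - #|B|, m).
  rewrite -cardC_ord -cards_draws -(card_imset _ val_inj); apply: eq_card => A.
  rewrite finset.inE; apply/imsetP/andP => [[a]|[AB Am]].
    by rewrite finset.inE disjoint_sym finset.disjoints_subset => aB ->;
      rewrite (valP a).
  by exists (exist _ A Am); rewrite ?finset.inE//= disjoint_sym
    finset.disjoints_subset.
have cM : #|{: {A : {set 'I_n} | #|A| == m}}| = 'C(n, m).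
  by rewrite card_sig -[X in 'C(X, m)]card_ord -card_draws cardsE;
    apply: eq_card => A; rewrite !inE.
rewrite !cardsX !cardsT cS [in RHS]card_prod [in RHS]card_prod cM; lia.
Qed.

(** The probability that one move chooses none of [v] given labels. *)
Definition avoid v : R := 'C(n - v, m)%:R / 'C(n, m)%:R.

Lemma hist_prob_avoid j (B : {set 'I_n}) :
  hist_prob R j (fun s : seq (move n p m) => [disjoint B & touched s]) = avoid
    #|B| ^+ j.
Proof.
elim: j => [|j IH].
  rewrite expr0 -(hist_probT R p mn 0); apply: eq_hist_prob => s /size0nil ->.
  by rewrite /touched big_nil disjoint_sym finset.disjoints_subset
    finset.sub0set.
rewrite hist_probS exprS; under eq_bigr => mv _.
  rewrite (@eq_hist_prob _ _ _ _ j _ (fun s => [disjoint B & touched s] &&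
    [disjoint B & chosen mv])); last first.
    move=> s _; rewrite /touched big_cons !(disjoint_sym B).
    by rewrite !finset.disjoints_subset finset.subUset andbC.
  rewrite hist_prob_andb IH; over.
rewrite -mulr_sumr mulrCA mulrC; congr (_ * _).
rewrite -natr_sum -big_mkcond/= sum1dep_card /avoid.
have N0 : #|{: move n p m}|%:R != 0 :> R by rewrite pnatr_eq0 -lt0n
  card_move_gt0.
have C0 : 'C(n, m)%:R != 0 :> R by rewrite pnatr_eq0 -lt0n bin_gt0.
apply: (mulfI N0); rewrite mulVKf//; apply: (mulIf C0).
by rewrite mulrA mulfVK// -!natrM card_move_avoid mulnC.
Qed.

(** ['C(u, v)] counts the [v]-subsets of the untouched labels. Exchanging sums leaves the
    probability that a fixed set is never met, a power by independence of the moves. *)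
Lemma factorial_moment j v :
  \sum_(u < n.+1) untouched_prob R n p m j u * 'C(u, v)%:R = 'C(n, v)%:R *
    avoid v ^+ j.
Proof.
have card_avoid (s : seq (move n p m)) : 'C(n - #|touched s|, v)%:R =
    \sum_(B : {set 'I_n} | #|B| == v) ([disjoint B & touched s])%:R :> R.
  rewrite -cardC_ord -cards_draws -sum1dep_card natr_sum big_mkcond
    [RHS]big_mkcond/=.
  apply: eq_bigr => B _; rewrite finset.disjoints_subset.
  by case: (B \subset _); case: (#|B| == v).
transitivity (\sum_(B : {set 'I_n} | #|B| == v) hist_prob R j (fun s : seq
  (move n p m) => [disjoint B & touched s])); last first.
  under eq_bigr => B /eqP Bv do rewrite hist_prob_avoid Bv.
  by rewrite sumr_const -[LHS]mulr_natl -[X in 'C(X, v)]card_ord -card_draws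
    cardsE.
transitivity (\sum_(s : j.-tuple (move n p m)) 'C(n - #|touched s|, v)%:R /
  #|{: move n p m}|%:R ^+ j : R); last first.
  under eq_bigr do rewrite card_avoid.
  rewrite -mulr_suml exchange_big mulr_suml/=; apply: eq_bigr => B _.
  by rewrite /hist_prob (card_histE R j (fun s : seq (move n p m) => [disjoint
    B & touched s])).
under eq_bigr => u _ do rewrite /untouched_prob /hist_prob mulrAC
  (card_histE R j (fun s : seq (move n p m) => (n - #|touched s|)%N == u))
    mulr_suml.
rewrite -mulr_suml exchange_big -mulr_suml/=; congr (_ / _);
  apply: eq_bigr => s _ /=.
have h : (n - #|touched s| < n.+1)%N by rewrite ltnS leq_subr.
rewrite (bigD1 (Ordinal h))//= eqxx mul1r big1 ?addr0// => u.
by rewrite -val_eqE/= eq_sym => /negbTE ->; rewrite mul0r.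
Qed.

End FactorialMoments.

(** * Inclusion-exclusion and two-sided bounds on the binomial moments *)

Lemma sum_alt_binom (R : realType) (k N : nat) : (k <= N)%N ->
  \sum_(w < N.+1) (-1) ^+ w * 'C(k, w)%:R = (k == 0%N)%:R :> R.
Proof.
move=> kN; have := exprDn (1 : R) (-1) k; rewrite subrr expr0n => ->.
rewrite -(big_mkord predT (fun w => (-1) ^+ w * 'C(k, w)%:R : R)).
rewrite (@big_cat_nat _ _ _ k.+1)//= [X in _ + X = _]big_nat_cond [X in _ + X =
  _]big1 ?addr0.
  by rewrite big_mkord; apply: eq_bigr => w _; rewrite expr1n mul1r mulr_natr.
by move=> w /andP[/andP[kw _] _]; rewrite bin_small ?mulr0.
Qed.

Lemma bin_mul_bin x u w :
  ('C(u + w, u) * 'C(x, u + w) = 'C(x, u) * 'C(x - u, w))%N.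
Proof.
have [xu|ux] := ltnP x u.
  by rewrite (bin_small xu) (@bin_small x (u + w)) ?muln0//; lia.
have [xw|wx] := ltnP (x - u) w.
  by rewrite (bin_small xw) (@bin_small x (u + w)) ?muln0//; lia.
have uwx : (u + w <= x)%N by lia.
have f1 := bin_fact uwx; have f2 := bin_fact ux; have f3 := bin_fact wx.
have := bin_fact (leq_addr w u); rewrite addKn => f4.
have e : (x - u - w = x - (u + w))%N by lia.
rewrite e in f3.
have P : (0 < u`! * w`! * (x - (u + w))`!)%N by rewrite !muln_gt0 !fact_gt0.
apply/eqP; rewrite -(eqn_pmul2r P); apply/eqP.
transitivity x`!; first by rewrite -f1 -f4; nia.
by rewrite -[LHS]f2 -f3; nia.
Qed.

(** By [bin_mul_bin] the sum is ['C(x, u)] times the expansion of [(1 - 1) ^ (x - u)]. *)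
Lemma inclusion_exclusion (R : realType) (x u N : nat) : (x <= N)%N ->
  (x == u)%:R = \sum_(w < N.+1) (-1) ^+ w * ('C(u + w, u) * 'C(x, u + w))%:R :>
    R.
Proof.
move=> xN; under eq_bigr do rewrite bin_mul_bin natrM mulrCA.
rewrite -mulr_sumr sum_alt_binom ?(leq_trans (leq_subr _ _))//.
have [xu|ux|->] := ltngtP x u.
- by rewrite bin_small// mul0r.
- by rewrite subn_eq0 leqNgt ux mulr0.
- by rewrite subnn binn mul1r.
Qed.

Section Moments.
Variables (R : realType) (n p m : nat).
Hypothesis mn : (m <= n)%N.
Variable j : nat.
Local Notation P := (untouched_prob R n p m j).

(** The [v]-th binomial moment of the number of untouched labels, by [factorial_moment]; [v!] times
    it is the factorial moment. *)
Definition moment v : R := 'C(n, v)%:R * avoid R n m v ^+ j.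

Lemma untouched_prob_moment u :
  P u = \sum_(w < n.+1) (-1) ^+ w * 'C(u + w, u)%:R * moment (u + w).
Proof.
under eq_bigr do rewrite /moment -(factorial_moment R p mn j) mulr_sumr.
rewrite exchange_big/=.
transitivity (\sum_(x < n.+1) P x * (x == u :> nat)%:R).
  have [un|nu] := leqP u n.
    rewrite (bigD1 (Ordinal (un : u < n.+1)%N))//= eqxx mulr1 big1 ?addr0// =>
      x.
    by rewrite -val_eqE/= => /negbTE ->; rewrite mulr0.
  rewrite untouched_prob_gt// big1// => x _; have := ltn_ord x.
  by case: eqP => [->|]; [lia|rewrite mulr0].
apply: eq_bigr => x _; rewrite (inclusion_exclusion R u (ltn_ord x : x <= n)%N)
  mulr_sumr.
by apply: eq_bigr => w _; rewrite natrM; ring.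
Qed.

(** [P u] is one term of the nonnegative sum that [factorial_moment] evaluates. This bound provides
    the domination of the density. *)
Lemma untouched_prob_le_moment u : P u <= moment u.
Proof.
have [un|nu] := leqP u n; last first.
  by rewrite untouched_prob_gt// /moment bin_small// mul0r.
rewrite /moment -(factorial_moment R p mn j) (bigD1 (Ordinal (un : u <
  n.+1)%N))//=.
rewrite binn mulr1 lerDl sumr_ge0// => x _.
by rewrite mulr_ge0 ?untouched_prob_ge0.
Qed.

Lemma avoid_ge0 v : 0 <= avoid R n m v.
Proof. by rewrite /avoid divr_ge0. Qed.

Lemma moment_ge0 v : 0 <= moment v.
Proof. by rewrite mulr_ge0// exprn_ge0// avoid_ge0. Qed.

(** The ratio of ['C(n - v - 1, m)] to ['C(n - v, m)]; the second alternative covers the range where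
    fewer than [m] labels lie outside the avoided set. *)
Lemma avoid_step v : (v < n)%N ->
  avoid R n m v.+1 = (1 - m%:R / (n - v)%:R) * avoid R n m v \/ avoid R n m v =
    0 /\ avoid R n m v.+1 = 0.
Proof.
move=> vn; have d0 : (n - v)%:R != 0 :> R by rewrite pnatr_eq0; lia.
have [mv|vm] := leqP m (n - v); [left|right]; last first.
  have e w : (v <= w)%N -> avoid R n m w = 0.
    by move=> vw; rewrite /avoid (@bin_small (n - w)) ?mul0r//; lia.
  by rewrite !e.
rewrite /avoid mulrA; congr (_ / _); apply: (mulfI d0).
rewrite mulrA mulrBr mulr1 [_ * (_ / _)]mulrC divfK// -natrB// -!natrM.
by have := mul_bin_down (n - v) m; rewrite (_ : (n - v).-1 = n - v.+1)%N =>
  [->//|]; lia.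
Qed.

Lemma avoid_le v : (0 < n)%N -> avoid R n m v <= (1 - m%:R / n%:R) ^+ v.
Proof.
move=> n0; have nr : 0 < n%:R :> R by rewrite ltr0n.
have r0 : 0 <= 1 - m%:R / n%:R :> R by rewrite subr_ge0 ler_pdivrMr// mul1r
  ler_nat.
elim: v => [|v IH].
  by rewrite expr0 /avoid subn0 divff// pnatr_eq0 -lt0n bin_gt0.
have [vn|nv] := ltnP v n; last first.
  (* Truncated subtraction makes [avoid] constant from [v = n] on: 1 if [m = 0], and 0 otherwise. *)
  have -> : avoid R n m v.+1 = avoid R n m v by rewrite /avoid;
    congr ('C(_, _)%:R / _); lia.
  have [m0|m0] := posnP m.
    by rewrite /avoid m0 mul0r subr0 expr1n !bin0 divr1.
  by rewrite /avoid (@bin_small (n - v)) ?mul0r ?exprn_ge0//; lia.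
have [->|[_ ->]] := avoid_step vn; last by rewrite exprn_ge0.
rewrite exprS; apply: (@le_trans _ _ ((1 - m%:R / n%:R) * avoid R n m v)).
  rewrite ler_wpM2r ?avoid_ge0// lerB// ler_wpM2l// lef_pV2 ?posrE ?ltr0n
    ?subn_gt0//.
  by rewrite ler_nat leq_subr.
by rewrite ler_wpM2l.
Qed.

Lemma avoid_ge v : (v + m <= n)%N -> (v < n)%N ->
  (1 - m%:R / (n - v)%:R) ^+ v <= avoid R n m v.
Proof.
move=> vmn vn.
have r0 : 0 <= 1 - m%:R / (n - v)%:R :> R.
  by rewrite subr_ge0 ler_pdivrMr ?ltr0n ?subn_gt0// mul1r ler_nat; lia.
suff h w : (w <= v)%N -> (1 - m%:R / (n - v)%:R) ^+ w <= avoid R n m w by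
  exact: h.
elim: w => [_|w IH wv].
  by rewrite expr0 /avoid subn0 divff// pnatr_eq0 -lt0n bin_gt0.
have C0 : 0 < 'C(n, m)%:R :> R by rewrite ltr0n bin_gt0.
have [|->|[a0 _]] := @avoid_step w; first by lia.
  rewrite exprS ler_pM ?exprn_ge0 ?IH//; last by lia.
  rewrite lerB// ler_wpM2l// lef_pV2 ?posrE ?ltr0n ?subn_gt0//; last by lia.
  by rewrite ler_nat; lia.
move/eqP: a0; rewrite /avoid mulf_eq0 invr_eq0 (gt_eqF C0) orbF pnatr_eq0
  -leqn0 leqNgt bin_gt0.
by lia.
Qed.

(** From [n ^_ v <= n ^ v] and [1 - x <= exp (- x)]. Being valid for all [v], it also serves as
    domination, whereas [moment_ge] is only used at fixed [v]. *)
Lemma moment_le v : (0 < n)%N ->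
  v`!%:R * moment v <= (n%:R * expR (- (m%:R * j%:R / n%:R))) ^+ v.
Proof.
move=> n0; have nr : 0 < n%:R :> R by rewrite ltr0n.
have r0 : 0 <= 1 - m%:R / n%:R :> R by rewrite subr_ge0 ler_pdivrMr// mul1r
  ler_nat.
rewrite /moment mulrA -natrM mulnC bin_ffact [leRHS]exprMn ler_pM// ?exprn_ge0
  ?avoid_ge0//.
  by rewrite -natrX ler_nat; elim: v => // v IH;
    rewrite ffactnSr expnSr leq_mul// leq_subr.
apply: (@le_trans _ _ (((1 - m%:R / n%:R) ^+ v) ^+ j)).
  by rewrite lerXn2r ?nnegrE ?exprn_ge0 ?avoid_ge0// avoid_le.
rewrite exprAC lerXn2r ?nnegrE ?exprn_ge0 ?expR_ge0//.
rewrite [X in expR X](_ : _ = - (m%:R / n%:R) * j%:R) ?expRM_natr; last by ring.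
rewrite lerXn2r ?nnegrE ?expR_ge0//.
by have := expR_ge1Dx (- (m%:R / n%:R : R)).
Qed.

Lemma moment_ge v : (v + m < n)%N ->
  ((n - v)%:R * expR (- (m%:R * j%:R / (n - (v + m))%:R))) ^+ v <= v`!%:R *
    moment v.
Proof.
move=> vmn; have d0 : 0 < (n - v)%:R :> R by rewrite ltr0n; lia.
have e0 : 0 < (n - (v + m))%:R :> R by rewrite ltr0n; lia.
have r0 : 0 <= 1 - m%:R / (n - v)%:R :> R.
  by rewrite subr_ge0 ler_pdivrMr// mul1r ler_nat; lia.
have -> : v`!%:R * moment v = (n ^_ v)%:R * avoid R n m v ^+ j.
  by rewrite /moment mulrA -natrM mulnC bin_ffact.
rewrite [leLHS]exprMn ler_pM// ?exprn_ge0 ?expR_ge0//.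
  rewrite -natrX ler_nat; have : (v <= n)%N by lia.
  suff h w : (w <= v)%N -> (v <= n -> (n - v) ^ w <= n ^_ w)%N by exact: h.
  elim: w => // w IH wv vn; rewrite ffactnSr expnSr leq_mul ?IH//; lia.
apply: (@le_trans _ _ (((1 - m%:R / (n - v)%:R) ^+ v) ^+ j)); last first.
  rewrite lerXn2r ?nnegrE ?exprn_ge0 ?avoid_ge0//; apply: avoid_ge; lia.
rewrite exprAC lerXn2r ?nnegrE ?exprn_ge0 ?expR_ge0//.
rewrite [X in expR X](_ : _ = - (m%:R / (n - (v + m))%:R) * j%:R) ?expRM_natr;
  last by ring.
rewrite lerXn2r ?nnegrE ?expR_ge0//.
(* For [y = m / (n - v - m)] the inverse of [1 + y] is [1 - m / (n - v)], so [1 + y <= exp y] is the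
   bound sought; this is where the denominator [n - (v + m)] comes from. *)
have x0 := expR_ge1Dx (m%:R / (n - (v + m))%:R : R).
rewrite expRN -[leRHS]invrK lef_pV2 ?posrE ?expR_gt0 ?invr_gt0//.
  apply: le_trans x0; rewrite le_eqVlt; apply/orP; left; apply/eqP.
  have -> : (n - v)%:R = (n - (v + m))%:R + m%:R :> R by rewrite -natrD;
    congr (_%:R); lia.
  have s0 : (n - (v + m))%:R + m%:R != 0 :> R by rewrite gt_eqF// ltr_wpDr.
  by field; rewrite s0 gt_eqF.
rewrite subr_gt0 ltr_pdivrMr// mul1r ltr_nat; lia.
Qed.

End Moments.

(** * Limits *)

Local Open Scope classical_set_scope.
Local Open Scope ring_scope.

Lemma cvg_big_ord (R : realType) (L : nat) (f : nat -> nat -> R) (g : nat -> R)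
  :
  (forall l, f n l @[n --> \oo] --> g l) ->
  \sum_(l < L) f n l @[n --> \oo] --> \sum_(l < L) g l.
Proof.
move=> h; elim: L => [|L IH].
  by under eq_fun do rewrite big_ord0; rewrite big_ord0; exact: cvg_cst.
under eq_fun do rewrite big_ord_recr; rewrite big_ord_recr/=.
exact: cvgD.
Qed.

(** Dominated convergence for sums whose range grows with [n]. *)
Lemma tannery (R : realType) (f : nat -> nat -> R) (g b : nat -> R) :
  (forall l, f n l @[n --> \oo] --> g l) ->
  (\forall n \near \oo, forall l, (l <= n)%N -> `|f n l| <= b l) ->
  cvgn (series b) ->
  \sum_(l < n.+1) f n l @[n --> \oo] --> limn (series g).
Proof.
move=> fg fb cb.
have gb l : `|g l| <= b l.
  apply: (cvgr_to_le (cvg_norm (fg l))); near=> n.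
  by apply: (near fb n) => //; near: n; exact: nbhs_infty_ge.
have b0 l : 0 <= b l by exact: le_trans (gb l).
have cg : cvgn (series g).
  apply: normed_cvg; apply: (series_le_cvg _ b0 gb cb) => l; exact: normr_ge0.
apply/cvgrPdist_le => e e0; have e3 : 0 < e / 3 by rewrite divr_gt0.
(* The index [L] splits the error in three: the tail of the limit, the fixed prefix, and the tail of
   the sums, bounded by that of [b]. *)
have [L [gL bL]] : exists L, `|limn (series g) - series g L| <= e / 3 /\
    `|limn (series b) - series b L| <= e / 3.
  near \oo => L; exists L; split; near: L.
    by have /cvgrPdist_le := cg; apply.
  by have /cvgrPdist_le := cb; apply.
near=> n.
have Ln : (L <= n.+1)%N by apply: ltnW; rewrite ltnS; near: n;
  exact: nbhs_infty_ge.
have h1 : `|series g L - \sum_(l < L) f n l| <= e / 3.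
  rewrite /series /= big_mkord; near: n.
  by have /cvgrPdist_le := @cvg_big_ord _ L f g fg; apply.
rewrite -(big_mkord predT (f n)) (@big_cat_nat _ _ _ L)//= big_mkord.
have h2 : `|\sum_(L <= l < n.+1) f n l| <= e / 3.
  apply: le_trans (ler_norm_sum _ _ _) _; apply: le_trans bL.
  apply: (@le_trans _ _ (\sum_(L <= l < n.+1) b l)).
    rewrite big_nat [leRHS]big_nat; apply: ler_sum => l /andP[_ ln].
    by have : forall l, (l <= n)%N -> `|f n l| <= b l; [near: n|apply].
  have -> : \sum_(L <= l < n.+1) b l = series b n.+1 - series b L.
    by rewrite sub_series Ln.
  apply: le_trans (ler_norm _); rewrite lerB//.
  apply: nondecreasing_cvgn_le => //; exact: nondecreasing_series.
move: gL h1 h2; rewrite !ler_norml => /andP[? ?] /andP[? ?] /andP[? ?].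
by apply/andP; split; lra.
Unshelve. all: by end_near. Qed.

Lemma cvg_cont (R : realType) (u : nat -> R) (h : R -> R) (a : R) :
  {for a, continuous h} -> u n @[n --> \oo] --> a -> h (u n) @[n --> \oo] --> h
    a.
Proof. by move=> ch ua; exact (@continuous_cvg _ _ _ _ _ u h a ch ua). Qed.

Lemma cvg_invn (R : realType) : (n%:R^-1 : R) @[n --> \oo] --> (0 : R).
Proof.
apply/(@gtr0_cvgV0 _ _ _ _ (fun n : nat => n%:R : R)); last exact: cvgr_idn.
by near=> n; rewrite ltr0n; near: n; exact: nbhs_infty_gt.
Unshelve. all: by end_near. Qed.

(** With [s = n^(-1/2)], the inequality [ln x < x] at [s^-1] gives [ln n < 2 / s], so the quotient
    is below [2 s]. *)
Lemma cvg_ln_div (R : realType) : (ln n%:R / n%:R : R) @[n --> \oo] --> (0 : R).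
Proof.
have h : (2 * Num.sqrt (n%:R^-1 : R)) @[n --> \oo] --> (0 : R).
  have hs : Num.sqrt (n%:R^-1 : R) @[n --> \oo] --> Num.sqrt (0 : R).
    apply: (@cvg_cont _ _ Num.sqrt _ _ (@cvg_invn R)); exact: sqrt_continuous.
  by rewrite -(mulr0 2); apply: cvgM; [exact: cvg_cst|rewrite sqrtr0 in hs].
apply: squeeze_cvgr (cvg_cst 0) h; near=> n.
have n1 : (0 < n)%N by near: n; exact: nbhs_infty_gt.
have nr : 0 < n%:R :> R by rewrite ltr0n.
rewrite divr_ge0 ?ln_ge0 ?ler1n//= ler_pdivrMr//.
set s := Num.sqrt (n%:R^-1).
have s0 : 0 < s by rewrite sqrtr_gt0 invr_gt0.
have -> : n%:R = s ^- 2 by rewrite sqr_sqrtr ?invrK// invr_ge0 ltW.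
rewrite lnV ?posrE ?exprn_gt0// lnXn// -mulNrn -lnV ?posrE//.
have := @ln_sublinear R s^-1; rewrite invr_gt0 s0 => /(_ isT).
have -> : 2 * s * s ^- 2 = s^-1 *+ 2 by field; rewrite gt_eqF.
by rewrite !mulr2n; lra.
Unshelve. all: by end_near. Qed.

(** * Poisson limit of the number of untouched labels *)

Section Asymptotics.
Variables (R : realType) (p m : nat).
Hypotheses (hp : (0 < p)%N) (hm : (0 < m)%N).

Lemma near_natr_ge (A : R) : \forall n \near \oo, A <= n%:R.
Proof. by have /cvgryPge := @cvgr_idn R; apply. Qed.

Lemma near_ln_ge0 (c : R) : \forall n \near \oo, 0 <= ln n%:R + c.
Proof.
near=> n; have h : expR (- c) <= n%:R by near: n; exact: near_natr_ge.
by rewrite -lerBlDr sub0r -[leLHS]expRK ler_ln ?posrE ?expR_gt0// (lt_le_trans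
  _ h) ?expR_gt0.
Unshelve. all: by end_near. Qed.

Lemma kn_lower (c : R) n : (0 < n)%N ->
  ln n%:R + c - m%:R / n%:R <= m%:R * (kn m c n)%:R / n%:R.
Proof.
move=> n0; have nr : 0 < n%:R :> R by rewrite ltr0n.
have mr : 0 < m%:R :> R by rewrite ltr0n.
have := truncnS_gt (n%:R / m%:R * (ln n%:R + c)); rewrite -/(kn m c n) -natr1.
set k := _%:R; rewrite mulrAC ltr_pdivrMr// => h.
by rewrite ler_pdivlMr// mulrBl divfK ?gt_eqF//; lra.
Qed.

Lemma kn_upper (c : R) n : 0 <= ln n%:R + c ->
  m%:R * (kn m c n)%:R <= n%:R * (ln n%:R + c).
Proof.
move=> h; have mr : 0 < m%:R :> R by rewrite ltr0n.
have : (kn m c n)%:R <= n%:R / m%:R * (ln n%:R + c).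
  by rewrite truncn_le mulr_ge0// divr_ge0.
by rewrite mulrAC ler_pdivlMr// mulrC.
Qed.

(** Upper bound for [n exp (- m k / n)]: the integer part lowers [k] by less than 1, which costs at
    most the factor [exp (m / n)]. *)
Definition up (c : R) (n : nat) : R := lam c * expR (m%:R / n%:R).

Lemma up_ge (c : R) n : (0 < n)%N ->
  n%:R * expR (- (m%:R * (kn m c n)%:R / n%:R)) <= up c n.
Proof.
move=> n0; have nr : 0 < n%:R :> R by rewrite ltr0n.
rewrite -[X in X * _ <= _](@lnK R) ?posrE// -expRD /up /lam -expRD ler_expR.
have := kn_lower c n0; lra.
Qed.

Lemma cvg_up (c : R) : up c n @[n --> \oo] --> lam c.
Proof.
rewrite -[X in _ --> X](_ : lam c * expR 0 = lam c);
  last by rewrite expR0 mulr1.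
apply: cvgM; first exact: cvg_cst.
apply: cvg_cont; first exact: continuous_expR.
rewrite -(mulr0 m%:R); apply: cvgM; [exact: cvg_cst|exact: cvg_invn].
Qed.

Lemma up_le (c : R) n : (0 < n)%N -> up c n <= lam c * expR m%:R.
Proof.
move=> n0; rewrite ler_wpM2l ?expR_ge0// ler_expR ler_pdivrMr ?ltr0n//.
by rewrite ler_peMr// ler1n.
Qed.

Lemma cvg_subn_div (b : nat) : ((n - b)%:R / n%:R : R) @[n --> \oo] --> (1 : R).
Proof.
have h : (1 - b%:R * n%:R^-1 : R) @[n --> \oo] --> (1 - b%:R * 0 : R).
  apply: cvgB; first exact: cvg_cst.
  by apply: cvgM; [exact: cvg_cst|exact: cvg_invn].
rewrite mulr0 subr0 in h; apply: cvg_trans h; apply: near_eq_cvg; near=> n.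
have bn : (b <= n)%N by near: n; exact: nbhs_infty_ge.
have n0 : (0 < n)%N by near: n; exact: nbhs_infty_gt.
by rewrite natrB// mulrBl divff// pnatr_eq0 -lt0n.
Unshelve. all: by end_near. Qed.

Lemma up_ge0 (c : R) n : 0 <= up c n.
Proof. by rewrite mulr_ge0 ?expR_ge0. Qed.

(** The base in [moment_ge] with [k] replaced by [n (ln n + c) / m]. Writing
    [n / (n - w) = 1 + w / (n - w)] with [w = v + m] splits off [exp (- ln n - c)]; the rest is
    expressed by quotients with known limits. *)
Definition lo (c : R) (v n : nat) : R := (n - v)%:R / n%:R * (lam c *
  expR (- ((v + m)%:R * ((ln n%:R / n%:R + c / n%:R) / ((n - (v + m))%:R /
    n%:R))))).

Lemma lo_ge0 (c : R) v n : 0 <= lo c v n.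
Proof. by rewrite mulr_ge0 ?divr_ge0// mulr_ge0 ?expR_ge0. Qed.

Lemma cvg_lo (c : R) v : lo c v n @[n --> \oo] --> lam c.
Proof.
rewrite -[X in _ --> X]mul1r; apply: cvgM; first exact: cvg_subn_div.
rewrite -[X in _ --> X](_ : lam c * expR 0 = lam c);
  last by rewrite expR0 mulr1.
apply: cvgM; first exact: cvg_cst.
apply: cvg_cont; first exact: continuous_expR.
suff : (- ((v + m)%:R * ((ln n%:R / n%:R + c / n%:R) / ((n - (v + m))%:R /
  n%:R))) : R)
    @[n --> \oo] --> (- ((v + m)%:R * ((0 + c * 0) / 1)) : R).
  by rewrite mulr0 addr0 mul0r mulr0 oppr0.
apply: cvgN; apply: cvgM; first exact: cvg_cst.
apply: cvgM; last first.
  exact (@cvgV _ _ _ _ (fun n => (n - (v + m))%:R / n%:R) 1 (oner_neq0 R)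
    (@cvg_subn_div _)).
apply: cvgD; first exact: cvg_ln_div.
by apply: cvgM; [exact: cvg_cst|exact: cvg_invn].
Qed.

Lemma lo_le (c : R) v n : (v + m < n)%N -> 0 <= ln n%:R + c ->
  lo c v n <= (n - v)%:R * expR (- (m%:R * (kn m c n)%:R / (n - (v + m))%:R)).
Proof.
move=> vmn lc; have n0 : (0 < n)%N by lia.
have nr : 0 < n%:R :> R by rewrite ltr0n.
have dr : 0 < (n - (v + m))%:R :> R by rewrite ltr0n; lia.
rewrite /lo -mulrA ler_wpM2l// -{1}(@lnK R n%:R) ?posrE// -expRN /lam -!expRD
  ler_expR.
rewrite -!opprD lerN2; apply: le_trans (_ : n%:R * (ln n%:R + c) / (n - (v +
  m))%:R <= _).
  by rewrite ler_wpM2r ?invr_ge0 ?(ltW dr)//; exact: kn_upper.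
set d := (n - (v + m))%:R in dr *.
have -> : (v + m)%:R = n%:R - d by rewrite /d (natrB _ (ltnW vmn)) opprB addrC
  subrK.
rewrite le_eqVlt; apply/orP; left; apply/eqP; field.
by rewrite !gt_eqF.
Qed.

Lemma cvg_moment (c : R) v :
  v`!%:R * moment R n m (kn m c n) v @[n --> \oo] --> lam c ^+ v.
Proof.
have hX (u : nat -> R) : u n @[n --> \oo] --> lam c -> u n ^+ v @[n --> \oo]
  --> lam c ^+ v.
  by move=> h; apply: (@cvg_cont _ _ (fun x => x ^+ v) _ _ h);
    exact: exprn_continuous.
have hlo := hX _ (@cvg_lo c v); have hup := hX _ (@cvg_up c).
apply: (squeeze_cvgr _ hlo hup); near=> n.
have vmn : (v + m < n)%N by near: n; exact: nbhs_infty_gt.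
have lc : 0 <= ln n%:R + c by near: n; exact: near_ln_ge0.
have mn : (m <= n)%N by lia.
have n0 : (0 < n)%N by lia.
apply/andP; split.
  apply: le_trans (moment_ge R mn _ vmn).
  by rewrite lerXn2r ?nnegrE ?lo_le ?lo_ge0// mulr_ge0 ?expR_ge0.
apply: le_trans (moment_le R mn _ _ n0) _.
by rewrite lerXn2r ?nnegrE ?up_ge ?up_ge0// mulr_ge0 ?expR_ge0.
Unshelve. all: by end_near. Qed.

Lemma moment_le_up (c : R) n v : (m <= n)%N ->
  v`!%:R * moment R n m (kn m c n) v <= up c n ^+ v.
Proof.
move=> mn; have n0 : (0 < n)%N by lia.
apply: le_trans (moment_le R mn _ _ n0) _.
by rewrite lerXn2r ?nnegrE ?up_ge ?up_ge0// mulr_ge0 ?expR_ge0.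
Qed.

(** The terms of the inclusion-exclusion sum tend to [lam ^ u / u!] times those of the series of
    [exp (- lam)]. *)
Lemma cvg_untouched_prob (c : R) u :
  untouched_prob R n p m (kn m c n) u @[n --> \oo] --> expR (- lam c) * lam c
    ^+ u / u`!%:R.
Proof.
(* Bounds [up c n] for all [n >= 1], hence is a valid base for the dominating exponential series. *)
set K := lam c * expR m%:R.
have K0 : 0 <= K by rewrite mulr_ge0 ?expR_ge0.
have fP k : 0 < k`!%:R :> R by rewrite ltr0n fact_gt0.
have binE w : 'C(u + w, u)%:R = (u + w)`!%:R / (u`!%:R * w`!%:R) :> R.
  have := bin_fact (leq_addr w u); rewrite addKn => <-.
  by rewrite !natrM mulfK// mulf_neq0// gt_eqF.
pose f n w : R := (-1) ^+ w * 'C(u + w, u)%:R * moment R n m (kn m c n) (u + w).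
pose g w : R := lam c ^+ u / u`!%:R * exp_coeff (- lam c) w.
have -> : expR (- lam c) * lam c ^+ u / u`!%:R = limn (series g).
  have h := @is_cvg_series_exp_coeff R (- lam c).
  by rewrite [RHS](lim_seriesZ (lam c ^+ u / u`!%:R) h) -mulrA mulrC.
have main : \sum_(w < n.+1) f n w @[n --> \oo] --> limn (series g).
  apply: (@tannery _ _ _ (fun w => K ^+ u / u`!%:R * exp_coeff K w)).
  - move=> w; rewrite /f /g.
    have -> : lam c ^+ u / u`!%:R * exp_coeff (- lam c) w =
        (-1) ^+ w * (u`!%:R * w`!%:R)^-1 * lam c ^+ (u + w).
      by rewrite /exp_coeff /= (exprNn (lam c)) exprD invfM;
        set e := (-1) ^+ w; ring.
    rewrite [X in X @ _ --> _](_ : _ = fun n => (-1) ^+ w * (u`!%:R *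
      w`!%:R)^-1 *
        ((u + w)`!%:R * moment R n m (kn m c n) (u + w))); last first.
      by apply/funext => n; rewrite binE; set e := (-1) ^+ w; ring.
    by apply: cvgM; [exact: cvg_cst|exact: cvg_moment].
  - near=> n => w wn; rewrite /f normrM normrM normrX normrN1 expr1n mul1r.
    have mn : (m <= n)%N by near: n; exact: nbhs_infty_ge.
    have n0 : (0 < n)%N by lia.
    rewrite !ger0_norm ?moment_ge0// binE.
    apply: (@le_trans _ _ ((u`!%:R * w`!%:R)^-1 * up c n ^+ (u + w))).
      by rewrite mulrC mulrA mulrC ler_wpM2l ?invr_ge0 ?mulr_ge0// mulrC
        moment_le_up.
    rewrite /exp_coeff /= mulrACA -exprD mulrC -invfM ler_wpM2r ?invr_ge0
      ?mulr_ge0//.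
    by rewrite lerXn2r ?nnegrE ?up_le// mulr_ge0 ?expR_ge0.
  - exact: is_cvg_seriesZ (@is_cvg_series_exp_coeff R K).
apply: cvg_trans main; apply: near_eq_cvg; near=> n.
have mn : (m <= n)%N by near: n; exact: nbhs_infty_ge.
by rewrite untouched_prob_moment.
Unshelve. all: by end_near. Qed.

End Asymptotics.

Lemma sum_expr_le (R : realType) (x : R) (l : nat) : 0 <= x ->
  \sum_(u < l.+1) x ^+ u <= (2 * (1 + x)) ^+ l.
Proof.
move=> x0; apply: (@le_trans _ _ (\sum_(u < l.+1) (1 + x) ^+ l)).
  apply: ler_sum => u _; apply: (@le_trans _ _ ((1 + x) ^+ u)).
    by rewrite lerXn2r ?nnegrE ?addr_ge0// lerDr.
  by rewrite ler_weXn2l ?lerDl// -ltnS.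
rewrite sumr_const card_ord exprMn -[leLHS]mulr_natl ler_wpM2r//.
  by rewrite exprn_ge0// addr_ge0.
by rewrite -natrX ler_nat ltn_expl.
Qed.

(** Away from 0 the power is [exp (q ln u)]. At the limit 0 the logarithm fails, and [u ^ q <= u]
    for [u <= 1] takes over, by [1 <= q]. *)
Lemma cvg_powR (R : realType) (u : nat -> R) (a q : R) : 1 <= q ->
  (forall n, 0 <= u n) -> u n @[n --> \oo] --> a -> u n `^ q @[n --> \oo] --> a
    `^ q.
Proof.
move=> q1 u0 ua; have q0 : 0 < q by rewrite (lt_le_trans ltr01).
have : 0 <= a by apply: (cvgr_to_ge ua); near=> n.
rewrite le_eqVlt => /orP[/eqP a0|a0].
  rewrite -a0 powR0 ?gt_eqF//; rewrite -a0 in ua.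
  apply: (squeeze_cvgr _ (cvg_cst 0) ua); near=> n.
  have u1 : u n <= 1.
    by near: n; have /cvgr_le := ua; apply; exact: ltr01.
  rewrite powR_ge0/=; have [->|un0] := eqVneq (u n) 0;
    first by rewrite powR0 ?gt_eqF.
  by rewrite -[leRHS]powRr1// ger_powR// lt_neqAle eq_sym un0 u0 u1.
have h : expR (q * ln (u n)) @[n --> \oo] --> expR (q * ln a).
  apply: cvg_cont; first exact: continuous_expR.
  by apply: cvgM; [exact: cvg_cst|apply: (cvg_cont (continuous_ln a0))].
have -> : a `^ q = expR (q * ln a) by rewrite /powR gt_eqF.
apply: cvg_trans h; apply: near_eq_cvg; near=> n.
have un0 : 0 < u n by near: n; have /cvgr_gt := ua; apply.
by rewrite /powR gt_eqF.
Unshelve. all: by end_near. Qed.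

(** * Convergence of the distances *)

Section Limits.
Variables (R : realType) (p m : nat).
Hypotheses (hp : (0 < p)%N) (hm : (0 < m)%N).
Variable c : R.
Local Notation D n := (density R n p m (kn m c n)).

Lemma rr_ge0 : 0 <= rr p c.
Proof. by rewrite mulr_ge0 ?expR_ge0. Qed.

Lemma cvg_untouched_prob_scaled u :
  untouched_prob R n p m (kn m c n) u * (u`!%:R * p.-1.+1%:R ^+ u) @[n --> \oo]
    --> expR (- lam c) * rr p c ^+ u.
Proof.
have -> : expR (- lam c) * rr p c ^+ u =
    expR (- lam c) * lam c ^+ u / u`!%:R * (u`!%:R * p.-1.+1%:R ^+ u).
  have f0 : u`!%:R != 0 :> R by rewrite pnatr_eq0 -lt0n fact_gt0.
  by rewrite mulrA divfK// prednK// -mulrA -exprMn [lam c * _]mulrC.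
by apply: cvgM; [exact: cvg_untouched_prob|exact: cvg_cst].
Qed.

Lemma untouched_prob_scaled_le n u : (m <= n)%N ->
  untouched_prob R n p m (kn m c n) u * (u`!%:R * p.-1.+1%:R ^+ u) <= (p%:R *
    up m c n) ^+ u.
Proof.
move=> mn; rewrite exprMn prednK// mulrCA mulrA mulrC ler_wpM2l ?exprn_ge0//.
apply: le_trans (moment_le_up hp hm c u mn).
by rewrite ler_wpM2l//; exact: untouched_prob_le_moment.
Qed.

Lemma cvg_density l : D n l @[n --> \oo] --> sl p c l.
Proof.
rewrite /sl mulr_sumr.
apply: (@cvg_big_ord _ l.+1 (fun n u => untouched_prob R n p m (kn m c n) u *
  (u`!%:R * p.-1.+1%:R ^+ u))
  (fun u => expR (- lam c) * rr p c ^+ u)).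
exact: cvg_untouched_prob_scaled.
Qed.

(** [sum_expr_le] at [p * lam c * exp m], a bound on [p * up] uniform in [n]. *)
Definition growth_base : R := 2 * (1 + p%:R * (lam c * expR m%:R)).

Lemma growth_base_ge2 : 2 <= growth_base.
Proof.
by rewrite /growth_base ler_peMr// lerDl mulr_ge0// mulr_ge0// expR_ge0.
Qed.

Lemma density_le n l : (m <= n)%N -> D n l <= growth_base ^+ l.
Proof.
move=> mn; have n0 : (0 < n)%N by lia.
have x0 : 0 <= p%:R * (lam c * expR m%:R) :> R by rewrite mulr_ge0// mulr_ge0
  ?expR_ge0.
apply: le_trans (sum_expr_le l x0); apply: ler_sum => u _.
apply: le_trans (untouched_prob_scaled_le _ mn) _.
have le_up : p%:R * up m c n <= p%:R * (lam c * expR m%:R) by rewrite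
  ler_wpM2l// up_le.
by rewrite lerXn2r ?nnegrE ?le_up// mulr_ge0 ?up_ge0.
Qed.

Lemma ell_tail_le_invfact l : ell_tail R p l <= l`!%:R^-1.
Proof.
have hp1 : (1 : R) <= p%:R ^+ l by rewrite exprn_ege1// ler1n.
have f0 : (0 : R) < l`!%:R by rewrite ltr0n fact_gt0.
by rewrite lef_pV2 ?posrE ?mulr_gt0 ?(lt_le_trans _ hp1)// ler_peMr// ltW.
Qed.

(** The mass at [l] is at most [1 / l!], which beats [C * B ^+ l]; so [F] may grow like any power on
    the range of the density. *)
Lemma cvg_functional (F : R -> R) (C B : R) : 0 <= C -> 0 <= B ->
  (forall l, F (D n l) @[n --> \oo] --> F (sl p c l)) ->
  (forall l x, 0 <= x <= growth_base ^+ l -> `|F x| <= C * B ^+ l) ->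
  \sum_(l < n.+1) ell_mass R n p l * F (D n l) @[n --> \oo] -->
    limn (series (fun l => al R p l * F (sl p c l))).
Proof.
move=> C0 B0 cF bF.
apply: (@tannery _ (fun n l => ell_mass R n p l * F (D n l))
  (fun l => al R p l * F (sl p c l)) (fun l => C * exp_coeff B l)).
- move=> l; apply: cvgM; last exact: cF.
  apply: cvg_near_cst; near=> n; apply: ell_mass_lt; near: n;
    exact: nbhs_infty_gt.
- near=> n => l ln; have mn : (m <= n)%N by near: n; exact: nbhs_infty_ge.
  rewrite normrM ger0_norm ?ell_mass_ge0//.
  apply: (@le_trans _ _ (l`!%:R^-1 * (C * B ^+ l))).
    rewrite ler_pM ?ell_mass_ge0 ?(le_trans (ell_mass_le _ _ _ _))
      ?ell_tail_le_invfact//.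
    by apply: bF; rewrite density_ge0 density_le.
  by rewrite /exp_coeff /= mulrCA [X in C * X]mulrC.
- exact: is_cvg_seriesZ (@is_cvg_series_exp_coeff R B).
Unshelve. all: by end_near. Qed.

Lemma sl_ge0 l : 0 <= sl p c l.
Proof. by have /andP[h _] := sl_bounds p c l; rewrite (le_trans _ h) ?expR_ge0.
  Qed.

Lemma sl_gt0 l : 0 < sl p c l.
Proof. by have /andP[h _] := sl_bounds p c l; rewrite (lt_le_trans _ h)
  ?expR_gt0. Qed.

Lemma near_mn : \forall n \near \oo, (m <= n)%N.
Proof. exact: nbhs_infty_ge. Qed.

Lemma cvg_sep :
  sep (convpow (Q R n p m) (kn m c n)) (U R) @[n --> \oo] --> s_prof p c.
Proof.
have -> : s_prof p c = 1 - sl p c (p == 1%N).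
  rewrite /s_prof /sl; case: eqP => p1 /=; last by rewrite big_ord1 expr0 mulr1.
  by rewrite big_ord_recl big_ord1 /= /rr p1 mul1r expr0 expr1.
have h : 1 - D n (p == 1%N) @[n --> \oo] --> 1 - sl p c (p == 1%N).
  by apply: cvgB; [exact: cvg_cst|exact: cvg_density].
apply: cvg_trans h; apply: near_eq_cvg; near=> n.
have mn : (m <= n)%N by near: n; exact: near_mn.
by rewrite sepE//; lia.
Unshelve. all: by end_near. Qed.

Lemma cvg_lq (q : R) : 1 <= q ->
  (lq_norm q (reldens (convpow (Q R n p m) (kn m c n)))) `^ q
       @[n --> \oo] --> Hq_prof q p c.
Proof.
move=> q1; have A2 := growth_base_ge2; have q0 : 0 < q by rewrite (lt_le_trans
  ltr01).
have h : \sum_(l < n.+1) ell_mass R n p l * (`|D n l - 1| `^ q) @[n --> \oo]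
  --> Hq_prof q p c.
  apply: (@cvg_functional (fun x => `|x - 1| `^ q) 1 (growth_base `^ q)) => //.
  - exact: powR_ge0.
  - move=> l; have h1 : `|D n l - 1| @[n --> \oo] --> `|sl p c l - 1|.
      by apply: cvg_norm; apply: cvgB; [exact: cvg_density|exact: cvg_cst].
    by apply: cvg_powR.
  - move=> l x /andP[x0 xA]; have A1l : 1 <= growth_base ^+ l by rewrite
    exprn_ege1//; lra.
    rewrite ger0_norm ?powR_ge0// mul1r.
    have -> : (growth_base `^ q) ^+ l = (growth_base ^+ l) `^ q.
      have A0 : 0 <= growth_base by lra.
      by rewrite -(powR_mulrn l (powR_ge0 _ _)) -(powR_mulrn l A0) -!powRrM
        mulrC.
    apply: ge0_ler_powR; rewrite ?nnegrE ?(ltW q0)//; first by lra.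
    by rewrite ler_norml; lra.
apply: cvg_trans h; apply: near_eq_cvg; near=> n.
by rewrite lq_normE//; near: n; exact: near_mn.
Unshelve. all: by end_near. Qed.

End Limits.

Section Limits2.
Variables (R : realType) (p m : nat).
Hypotheses (hp : (0 < p)%N) (hm : (0 < m)%N).
Variable c : R.
Local Notation D n := (density R n p m (kn m c n)).

Lemma cvg_KL :
  KL (convpow (Q R n p m) (kn m c n)) (U R) @[n --> \oo] --> h_prof p c.
Proof.
have A2 := growth_base_ge2 p m c.
have h : \sum_(l < n.+1) ell_mass R n p l * (D n l * ln (D n l)) @[n --> \oo]
  --> h_prof p c.
  apply: (@cvg_functional R p m hp hm c (fun x => x * ln x) 2 (growth_base p m
    c ^+ 2)) => //.
  - by rewrite exprn_ge0//; lra.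
  - move=> l; apply: cvgM; first exact: cvg_density.
    have hD : D n l @[n --> \oo] --> sl p c l by exact: cvg_density.
    by apply: (@cvg_cont _ _ (@ln R) _ _ hD); apply: continuous_ln;
      exact: sl_gt0.
  - move=> l x /andP[x0 xA].
    have A1l : 1 <= growth_base p m c ^+ l by rewrite exprn_ege1//; lra.
    (* The bound combines [ln x < x] with the same inequality at [x^-1], which gives
       [- x ln x < 1]. *)
    apply: (@le_trans _ _ (1 + x ^+ 2)); last first.
      have : x ^+ 2 <= (growth_base p m c ^+ l) ^+ 2 by rewrite lerXn2r
        ?nnegrE// (le_trans x0).
      have : 1 <= (growth_base p m c ^+ l) ^+ 2 by rewrite exprn_ege1.
      by rewrite [(_ ^+ 2) ^+ l]exprAC; lra.
    move: x0; rewrite le_eqVlt => /orP[/eqP <-|x0].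
      by rewrite mul0r normr0 expr0n addr0.
    have := ln_sublinear x0; have : - ln x < x^-1.
      by rewrite -lnV ?posrE// ln_sublinear// invr_gt0.
    rewrite -(ltr_pM2l x0) mulfV ?gt_eqF// mulrN => h1 h2.
    by rewrite ler_norml; nra.
apply: cvg_trans h; apply: near_eq_cvg; near=> n.
by rewrite KLE//; near: n; exact: near_mn.
Unshelve. all: by end_near. Qed.

Lemma sl_nondecreasing l l' : (l <= l')%N -> sl p c l <= sl p c l'.
Proof.
move=> ll'; rewrite /sl ler_wpM2l ?expR_ge0//.
rewrite -!(big_mkord predT (fun u => rr p c ^+ u)) (@big_cat_nat _ _ _ l.+1 0
  l'.+1)//=.
by rewrite lerDl sumr_ge0// => u _; rewrite exprn_ge0// rr_ge0.
Qed.

Lemma slS l : sl p c l.+1 = sl p c l + expR (- lam c) * rr p c ^+ l.+1.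
Proof. by rewrite /sl big_ord_recr mulrDr. Qed.

Lemma ell_tail_rr l : ell_tail R p l * rr p c ^+ l = lam c ^+ l / l`!%:R.
Proof.
have p0 : p%:R != 0 :> R by rewrite pnatr_eq0 -lt0n.
rewrite /ell_tail /rr exprMn invfM -mulrA mulKf ?expf_neq0//.
by rewrite mulrC.
Qed.

(** Abel summation: [al] is a difference of [ell_tail], and [ell_tail_rr] turns the increments of
    [sl] into Poisson weights. *)
Lemma sum_al_deficit w : \sum_(l < w.+1) al R p l * (1 - sl p c l) =
  1 - expR (- lam c) * (\sum_(u < w.+1) lam c ^+ u / u`!%:R) + (sl p c w - 1) *
    ell_tail R p w.+1.
Proof.
elim: w => [|w IH].
  rewrite !big_ord1 alE /sl big_ord1 [ell_tail R p 0]/ell_tail !expr0 fact0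
    mulr1 invr1.
  by set b := ell_tail R p 1; ring.
rewrite big_ord_recr IH [in RHS]big_ord_recr/= -ell_tail_rr alE slS; ring.
Qed.

(** As [sl] is nondecreasing in [l], the deficit [1 - sl] is nonnegative exactly below [wstar]; the
    series is a finite sum, evaluated by [sum_al_deficit]. *)
Lemma f_profE (w0 : (0 < p)%N) :
  f_prof w0 c = limn (series (fun l => al R p l * Num.max 0 (1 - sl p c l))).
Proof.
rewrite /f_prof /wstar; case: ex_minnP => w w1 wmin.
(* [sl p c 0 = exp (- lam c) <= 1] excludes [wstar = 0], so the sum has the successor form of
   [sum_al_deficit]. *)
have wpos : (0 < w)%N.
  rewrite lt0n; apply/eqP => w00; move: w1; rewrite w00 /sl big_ord1 expr0
    mulr1.
  by rewrite ltNge -expR0 ler_expR oppr_le0 expR_ge0.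
have hlt l : (l < w)%N -> Num.max 0 (1 - sl p c l) = 1 - sl p c l.
  move=> lw; apply/max_idPr; rewrite subr_ge0 leNgt; apply/negP => /wmin.
  by rewrite leqNgt lw.
have hge l : (w <= l)%N -> Num.max 0 (1 - sl p c l) = 0.
  move=> wl; apply/max_idPl; rewrite subr_le0.
  by rewrite (le_trans (ltW w1))// sl_nondecreasing.
transitivity (\sum_(l < w) al R p l * (1 - sl p c l)); last first.
  apply/esym/lim_near_cst; first exact: Rhausdorff.
  near=> n; have wn : (w <= n)%N by near: n; exact: nbhs_infty_ge.
  rewrite /series /= (@big_cat_nat _ _ _ w)//= big_mkord [X in _ + X]big_nat [X
    in _ + X]big1 ?addr0.
    by apply: eq_bigr => l _; rewrite hlt.
  by move=> l /andP[wl _]; rewrite hge// mulr0.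
case: w wpos {w1 wmin hlt hge} => // w _.
by rewrite sum_al_deficit /sl /ell_tail.
Unshelve. all: by end_near. Qed.

Lemma cvg_tv (w0 : (0 < p)%N) :
  tv (convpow (Q R n p m) (kn m c n)) (U R) @[n --> \oo] --> f_prof w0 c.
Proof.
rewrite f_profE.
have h : \sum_(l < n.+1) ell_mass R n p l * Num.max 0 (1 - D n l) @[n --> \oo]
  -->
    limn (series (fun l => al R p l * Num.max 0 (1 - sl p c l))).
  apply: (@cvg_functional R p m hp hm c (fun x => Num.max 0 (1 - x)) 1 1) => //.
  - move=> l; have maxE (x : R) : Num.max 0 x = (x + `|x|) / 2.
      by rewrite maxr_absE sub0r normrN add0r.
    under eq_fun do rewrite maxE; rewrite maxE.
    have h1 : (1 - D n l) @[n --> \oo] --> 1 - sl p c l.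
      by apply: cvgB; [exact: cvg_cst|exact: cvg_density].
    by apply: cvgM; [apply: cvgD => //; exact: cvg_norm|exact: cvg_cst].
  - move=> l x /andP[x0 _]; rewrite expr1n mulr1 ger0_norm ?le_max ?lexx//.
    by rewrite ge_max ler01 gerBl.
apply: cvg_trans h; apply: near_eq_cvg; near=> n.
by rewrite tvE//; near: n; exact: near_mn.
Unshelve. all: by end_near. Qed.

End Limits2.

(** * Closed form of the chi-square profile, and the sup norm *)

Section Limits3.
Variables (R : realType) (p m : nat).
Hypotheses (hp : (0 < p)%N) (hm : (0 < m)%N).
Variable c : R.
Local Notation D n := (density R n p m (kn m c n)).
Local Notation L := (lam c).
Local Notation r := (rr p c).

(** [sl] with its index shifted by one and [geom 0 = 0], which spares a predecessor in the summation
    by parts. *)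
Definition geom (l : nat) : R := expR (- L) * \sum_(u < l) r ^+ u.

Lemma geom_ge0 l : 0 <= geom l.
Proof.
rewrite mulr_ge0 ?expR_ge0// sumr_ge0// => u _; rewrite exprn_ge0//;
  exact: rr_ge0.
Qed.

Lemma geomS l : geom l.+1 = geom l + expR (- L) * r ^+ l.
Proof. by rewrite /geom big_ord_recr mulrDr. Qed.

(** Abel summation; the difference of consecutive squares of [geom] is the increment
    [exp (- L) * r ^+ l] times the sum of both terms. *)
Lemma sum_al_sq N : \sum_(l < N) al R p l * sl p c l ^+ 2 =
  \sum_(l < N) expR (- L) * (L ^+ l / l`!%:R) * (geom l.+1 + geom l) - ell_tail
    R p N * geom N ^+ 2.
Proof.
elim: N => [|N IH].
  by rewrite !big_ord0 /geom big_ord0 mulr0 expr0n mulr0 subr0.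
rewrite !big_ord_recr IH/= -(ell_tail_rr hp) alE -[sl p c N]/(geom N.+1) geomS;
  ring.
Qed.

Lemma cvg_ell_tail_geom : ell_tail R p n * geom n ^+ 2 @[n --> \oo] --> (0 : R).
Proof.
have h := cvg_series_cvg_0 (@is_cvg_series_exp_coeff R ((2 * (1 + r)) ^+ 2)).
apply: (squeeze_cvgr _ (cvg_cst 0) h); near=> n.
rewrite mulr_ge0 ?(ltW (ell_tail_gt0 _ hp _)) ?exprn_ge0 ?geom_ge0//=.
rewrite /exp_coeff /= [leRHS]mulrC ler_pM ?(ltW (ell_tail_gt0 _ hp _))
  ?exprn_ge0 ?geom_ge0 ?ell_tail_le_invfact//.
have /andP[_ h2] := sl_bounds p c n; rewrite exprAC.
have r0 : 0 <= r by exact: rr_ge0.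
have geom_le_sl : geom n <= sl p c n.
  by rewrite -[sl p c n]/(geom n.+1) geomS lerDl mulr_ge0 ?expR_ge0 ?exprn_ge0.
by rewrite lerXn2r ?nnegrE ?geom_ge0 ?(le_trans geom_le_sl)// exprn_ge0//
  mulr_ge0// addr_ge0.
Unshelve. all: by end_near. Qed.

Lemma cvg_series_expR (x : R) : \sum_(l < n) x ^+ l / l`!%:R @[n --> \oo] -->
  expR x.
Proof.
have h := @is_cvg_series_exp_coeff R x.
by under eq_fun do rewrite -(big_mkord predT (fun l => x ^+ l / l`!%:R)).
Qed.

Lemma sum_index_expR (x : R) n :
  \sum_(l < n.+1) l%:R * (x ^+ l / l`!%:R) = x * \sum_(l < n) x ^+ l / l`!%:R.
Proof.
rewrite big_ord_recl mul0r add0r mulr_sumr; apply: eq_bigr => l _.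
rewrite lift0 factS natrM exprS invfM.
have a0 : l.+1%:R != 0 :> R by rewrite pnatr_eq0.
transitivity (l.+1%:R / l.+1%:R * (x * (x ^+ l / l`!%:R)));
  last by rewrite divff// mul1r.
by move: (_%:R^-1) (l.+1%:R) => b a; ring.
Qed.

Lemma cvg_sum_al_sq :
  \sum_(l < n) al R p l * sl p c l ^+ 2 @[n --> \oo] --> g_prof p c + 1.
Proof.
suff main : \sum_(l < n) expR (- L) * (L ^+ l / l`!%:R) * (geom l.+1 + geom l)
    @[n --> \oo] --> g_prof p c + 1.
  have h := cvgB main cvg_ell_tail_geom; rewrite subr0 in h.
  by under eq_fun do rewrite sum_al_sq; exact: h.
(* At [r = 1] the geometric sum degenerates to [exp (- L) * l], and the sum of [l * L ^ l / l!]
   appears. *)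
rewrite /g_prof; case: eqP => [r1|/eqP r1].
  have geomE l : geom l = expR (- L) * l%:R.
    rewrite /geom r1; congr (_ * _); under eq_bigr do rewrite expr1n.
    by rewrite sumr_const card_ord.
  rewrite -cvg_shiftS/=.
  have -> : (2 * L + 1) * expR (- L) - 1 + 1 =
      2 * (expR (- L) * expR (- L)) * (L * expR L) + expR (- L) * expR (- L) *
        expR L.
    have : expR (- L) * expR L = 1 by rewrite -expRD addNr expR0.
    set e := expR (- L); set e' := expR L => ee.
    by transitivity (2 * e * (e * e') * L + e * (e * e')); [rewrite ee|]; ring.
  under eq_fun => n.
    have -> : \sum_(l < n.+1) expR (- L) * (L ^+ l / l`!%:R) * (geom l.+1 +
      geom l) =
       2 * (expR (- L) * expR (- L)) * (L * \sum_(l < n) L ^+ l / l`!%:R)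
       + expR (- L) * expR (- L) * \sum_(l < n.+1) L ^+ l / l`!%:R.
      rewrite -sum_index_expR !mulr_sumr -big_split/=; apply: eq_bigr => l _.
      by rewrite !geomE -natr1; set x := _ / _; ring.
    over.
  apply: cvgD; apply: cvgM; try exact: cvg_cst.
    by apply: cvgM; [exact: cvg_cst|exact: cvg_series_expR].
  by have := @cvg_series_expR L; rewrite -cvg_shiftS.
have r10 : r - 1 != 0 by rewrite subr_eq0.
have geomE l : geom l = expR (- L) * ((r ^+ l - 1) / (r - 1)).
  by rewrite /geom subrX1 [(r - 1) * _]mulrC mulfK.
have -> : (r + 1) / (r - 1) * expR (- (L * (2 - r))) - 2 / (r - 1) * expR (- L)
  - 1 + 1 =
    expR (- L) * expR (- L) / (r - 1) * ((r + 1) * expR (L * r) - 2 * expR L).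
  have : expR (- L) * expR L = 1 by rewrite -expRD addNr expR0.
  have -> : - (L * (2 - r)) = - L + - L + L * r by ring.
  rewrite !expRD; set e := expR (- L); set e' := expR L; set f := expR _ => ee.
  rewrite subrK; transitivity ((r + 1) / (r - 1) * (e * e * f) - 2 / (r - 1) *
    e * (e * e')).
    by rewrite ee mulr1.
  by field.
under eq_fun => n.
  have -> : \sum_(l < n) expR (- L) * (L ^+ l / l`!%:R) * (geom l.+1 + geom l) =
     expR (- L) * expR (- L) / (r - 1) * ((r + 1) * \sum_(l < n) (L * r) ^+ l /
       l`!%:R
       - 2 * \sum_(l < n) L ^+ l / l`!%:R).
    rewrite !mulr_sumr -sumrB mulr_sumr; apply: eq_bigr => l _.
    rewrite !geomE (exprMn l L r) (exprS r l); set f := l`!%:R^-1;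
      set x := L ^+ l; set y := r ^+ l.
    by field.
  over.
apply: cvgM; first exact: cvg_cst.
by apply: cvgB; apply: cvgM; try exact: cvg_cst; exact: cvg_series_expR.
Qed.

Lemma cvg_chi2 :
  chi2 (convpow (Q R n p m) (kn m c n)) @[n --> \oo] --> g_prof p c.
Proof.
have A2 := growth_base_ge2 p m c.
have h : \sum_(l < n.+1) ell_mass R n p l * (D n l) ^+ 2 - 1 @[n --> \oo] -->
  g_prof p c.
  rewrite -[X in _ --> X](addrK 1); apply: cvgB; last exact: cvg_cst.
  have -> : g_prof p c + 1 = limn (series (fun l => al R p l * (sl p c l) ^+
    2)).
    apply/esym/cvg_lim; first exact: Rhausdorff.
    rewrite (_ : series _ = fun n => \sum_(l < n) al R p l * sl p c l ^+ 2).
      exact: cvg_sum_al_sq.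
    by apply/funext => n; rewrite /series /= big_mkord.
  apply: (@cvg_functional R p m hp hm c (fun x => x ^+ 2) 1 (growth_base p m c
    ^+ 2)) => //.
  - by rewrite exprn_ge0//; lra.
  - move=> l; have hD : D n l @[n --> \oo] --> sl p c l by exact: cvg_density.
    exact: (cvgM hD hD).
  - move=> l x /andP[x0 xA]; rewrite mul1r normrX ger0_norm// exprAC.
    by rewrite lerXn2r ?nnegrE// (le_trans x0).
apply: cvg_trans h; apply: near_eq_cvg; near=> n.
by rewrite chi2E//; near: n; exact: near_mn.
Unshelve. all: by end_near. Qed.

(** For [r >= 1], [D n n] is eventually at least each fixed [D n l], whose limit grows at least
    linearly in [l]. For [r < 1] its terms are dominated by a geometric series. *)
Lemma cvg_linf :
  (linf_norm (reldens (convpow (Q R n p m) (kn m c n))))%:E @[n --> \oo] -->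
    Hinf_prof p c.
Proof.
suff h : (D n n - 1)%:E @[n --> \oo] --> Hinf_prof p c.
  apply: cvg_trans h; apply: near_eq_cvg; near=> n.
  have mn : (m <= n)%N by near: n; exact: near_mn.
  have n1 : (1 < n)%N by near: n; exact: nbhs_infty_gt.
  by rewrite linf_normE//; lia.
rewrite /Hinf_prof; case: ltP => r1; last first.
  apply/cvgeryP/cvgryPge => A.
  have e0 : 0 < expR (- L) by exact: expR_gt0.
  have [l hl] : exists l : nat, A + 2 <= expR (- L) * l%:R.
    exists (Num.truncn ((A + 2) / expR (- L))).+1.
    by rewrite -ler_pdivrMl// mulrC ltW// truncnS_gt.
  have sl2 : A + 1 < sl p c l.
    apply: (@lt_le_trans _ _ (A + 2)); first by lra.
    apply: le_trans hl _.
    rewrite /sl ler_wpM2l ?(ltW e0)//.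
    apply: (@le_trans _ _ (\sum_(u < l.+1) 1)).
      by rewrite sumr_const card_ord ler_nat.
    by apply: ler_sum => u _; rewrite exprn_ege1.
  near=> n; rewrite lerBrDr.
  apply: (@le_trans _ _ (D n l)).
    near: n; have /cvgr_ge := @cvg_density R p m hp hm c l; apply; exact: sl2.
  by apply: density_nondecreasing; near: n; exact: nbhs_infty_ge.
apply/cvg_EFin; first by near=> n.
have r0 : 0 <= r by exact: rr_ge0.
have r1n : `|r| < 1 by rewrite ger0_norm.
have -> : expR (- L) / (1 - r) = limn (series (geometric (expR (- L)) r)).
  by apply/esym/cvg_lim; [exact: Rhausdorff|exact: cvg_geometric_series].
apply: cvgB; last exact: cvg_cst.
(* A ratio strictly between [r] and 1; [p * up] tends to [r], hence is eventually below it. *)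
pose rho := (1 + r) / 2.
have rrho : r < rho by rewrite /rho; lra.
apply: (@tannery _ (fun n u => untouched_prob R n p m (kn m c n) u * (u`!%:R *
  p.-1.+1%:R ^+ u))
  (geometric (expR (- L)) r) (geometric 1 rho)).
- by move=> u; exact: cvg_untouched_prob_scaled.
- near=> n => u un.
  have mn : (m <= n)%N by near: n; exact: near_mn.
  rewrite ger0_norm; last by rewrite mulr_ge0 ?untouched_prob_ge0// mulr_ge0.
  apply: le_trans (untouched_prob_scaled_le hp hm c u mn) _.
  have hup : p%:R * up m c n <= rho.
    near: n; have h : p%:R * up m c n @[n --> \oo] --> r.
      by apply: cvgM; [exact: cvg_cst|exact: cvg_up].
    have /cvgr_le := h; apply; exact: rrho.
  have rho0 : 0 <= rho by rewrite /rho; lra.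
  have up0 : 0 <= p%:R * up m c n by rewrite mulr_ge0 ?up_ge0.
  by rewrite /geometric /= mul1r lerXn2r ?nnegrE.
- apply: is_cvg_geometric_series; rewrite ger0_norm /rho; lra.
Unshelve. all: by end_near. Qed.

End Limits3.

(** * Monotonicity in time and the cutoff profile *)

Lemma Q_ge0 (R : realType) n p m (x : cperm n p) : 0 <= Q R n p m x.
Proof. by rewrite /Q /unif divr_ge0. Qed.

Lemma sum_Q (R : realType) n p m : (m <= n)%N -> \sum_(x : cperm n p) Q R n p m
  x = 1.
Proof.
move=> mn; rewrite /Q /unif -mulr_suml -natr_sum -big_mkcond/= sum1_card
  divff//.
by rewrite pnatr_eq0 -lt0n card_top_set card_sorted_from_move// card_move_gt0.
Qed.

(** [U] is translation invariant, so the difference to [U] is convolved with a probability, which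
    cannot increase its L1 norm. *)
Lemma tv_conv (R : realType) (G : finGroupType) (M N : G -> R) :
  (forall x, 0 <= M x) -> \sum_x M x = 1 -> tv (Defs.conv N M) (U R) <= tv N (U
    R).
Proof.
move=> M0 M1; rewrite /tv ler_wpM2l ?invr_ge0//.
have Uxy (x y : G) : U R x = U R y by rewrite /U /unif !finset.inE.
apply: (@le_trans _ _ (\sum_(z : G) \sum_(u : G) `|N (z * u^-1)%g - U R (z *
  u^-1)%g| * M u)).
  apply: ler_sum => z _; rewrite -[U R z]mulr1 -M1 mulr_sumr /Defs.conv -sumrB.
  apply: le_trans (ler_norm_sum _ _ _) _; apply: ler_sum => u _.
  by rewrite (Uxy z (z * u^-1)%g) -mulrBl normrM (ger0_norm (M0 u)).
rewrite exchange_big/= -[leRHS]mul1r -M1 mulr_suml; apply: ler_sum => u _.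
by rewrite -mulr_suml mulrC ler_wpM2l// [leRHS](reindex_inj (mulIg u^-1%g)).
Qed.

Section Cutoff.
Variables (R : realType) (p m : nat).
Hypotheses (hp : (0 < p)%N) (hm : (0 < m)%N).

Lemma tv_nincr n k k' : (m <= n)%N -> (k <= k')%N ->
  tv (convpow (Q R n p m) k') (U R) <= tv (convpow (Q R n p m) k) (U R).
Proof.
move=> mn /subnK <-; elim: (k' - k)%N => // i IH.
rewrite addSn; apply: le_trans IH; apply: tv_conv; [exact: Q_ge0|exact: sum_Q].
Qed.

Lemma tv_bounds n k : (m <= n)%N -> 0 <= tv (convpow (Q R n p m) k) (U R) <= 1.
Proof.
move=> mn; apply/andP; split; first by rewrite mulr_ge0 ?invr_ge0// sumr_ge0.
rewrite tvE// -[leRHS](sum_ell_mass R n hp); apply: ler_sum => l _.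
by rewrite ler_piMr ?ell_mass_ge0// ge_max ler01 gerBl density_ge0.
Qed.

(** Inherited from the distances of the walk in the limit; the closed form shows neither this nor
    the monotonicity proved next. *)
Lemma f_prof_bounds (c : R) : 0 <= f_prof hp c <= 1.
Proof.
have h := @cvg_tv R p m hp hm c hp; apply/andP; split.
  apply: (cvgr_to_ge h); near=> n.
  have mn : (m <= n)%N by near: n; exact: near_mn.
  by have /andP[] := @tv_bounds n (kn m c n) mn.
apply: (cvgr_to_le h); near=> n.
have mn : (m <= n)%N by near: n; exact: near_mn.
by have /andP[] := @tv_bounds n (kn m c n) mn.
Unshelve. all: by end_near. Qed.

Lemma f_prof_nincr (c c' : R) : c <= c' -> f_prof hp c' <= f_prof hp c.
Proof.
move=> cc'; apply: (ler_cvg_to (@cvg_tv R p m hp hm c' hp) (@cvg_tv R p m hp hm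
  c hp)); near=> n.
apply: tv_nincr; first by near: n; exact: near_mn.
by apply: le_truncn; rewrite ler_wpM2l ?divr_ge0// lerD2l.
Unshelve. all: by end_near. Qed.

Lemma sum_al N : \sum_(l < N) al R p l = 1 - ell_tail R p N.
Proof.
elim: N => [|N IH]; first by rewrite big_ord0 /ell_tail fact0 expr0 mulr1 invr1
  subrr.
by rewrite big_ord_recr IH/= alE addrA subrK.
Qed.

Lemma f_prof_cvg (c : R) : series (fun l => al R p l * Num.max 0 (1 - sl p c
  l)) n
  @[n --> \oo] --> f_prof hp c.
Proof.
have h : cvgn (series (fun l => al R p l * Num.max 0 (1 - sl p c l))).
  apply: (@al_series_cvg R p (fun l => Num.max 0 (1 - sl p c l)) 1 1) => // l.
  rewrite expr1n mulr1 ger0_norm ?le_max ?lexx// ge_max ler01 gerBl.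
  exact: sl_ge0.
by rewrite f_profE//; exact: h.
Qed.

(** Each deficit is at most [1 - exp (- lam c) <= lam c], and the weights sum to at most 1. *)
Lemma f_prof_le (c : R) : f_prof hp c <= expR (- c).
Proof.
apply: (cvgr_to_le (@f_prof_cvg c)); near=> n; rewrite /series /= big_mkord.
have e1 : expR (- lam c) <= 1 by rewrite -expR0 ler_expR oppr_le0 expR_ge0.
apply: (@le_trans _ _ (\sum_(l < n) al R p l * (1 - expR (- lam c)))).
  apply: ler_sum => l _; rewrite ler_wpM2l ?al_ge0// ge_max subr_ge0 e1/=.
  by have /andP[h _] := sl_bounds p c l; rewrite lerB.
rewrite -mulr_suml sum_al; have b0 := ell_tail_gt0 R hp n.
have : 1 - expR (- lam c) <= lam c by have := expR_ge1Dx (- lam c); lra.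
by rewrite -/(lam c); nra.
Unshelve. all: by end_near. Qed.

Lemma f_prof_ge (c : R) N : (1 - ell_tail R p N) * (1 - sl p c N) <= f_prof hp
  c.
Proof.
apply: (cvgr_to_ge (@f_prof_cvg c)); near=> n; rewrite /series /=.
have Nn : (N <= n)%N by near: n; exact: nbhs_infty_ge.
rewrite (@big_cat_nat _ _ _ N)//= -sum_al mulr_suml -[leLHS]addr0 big_mkord.
apply: lerD.
  apply: ler_sum => l _; rewrite ler_wpM2l ?al_ge0// le_max lerB ?orbT//.
  by apply: sl_nondecreasing; exact: ltnW.
by apply: sumr_ge0 => l _; rewrite mulr_ge0 ?al_ge0// le_max lexx.
Unshelve. all: by end_near. Qed.

(** [lam ^ (N + 1) / (N + 1)! <= exp lam] has one power more than the geometric sum. The 4 comes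
    from [1 + r <= 2 r], as [r >= 1]. *)
Lemma sl_le (c : R) N : 1 <= lam c -> sl p c N <= N.+1`!%:R * (4 * p%:R) ^+ N /
  lam c.
Proof.
move=> l1; have l0 : 0 < lam c by rewrite (lt_le_trans ltr01).
have p1 : 1 <= p%:R :> R by rewrite ler1n.
have f0 : 0 < N.+1`!%:R :> R by rewrite ltr0n fact_gt0.
have h1 : \sum_(u < N.+1) rr p c ^+ u <= (4 * p%:R * lam c) ^+ N.
  apply: le_trans (sum_expr_le N (rr_ge0 p c)) _.
  rewrite lerXn2r ?nnegrE ?mulr_ge0 ?addr_ge0 ?rr_ge0 ?(ltW l0)//.
  have : 1 <= rr p c by rewrite /rr; nra.
  by rewrite -!mulrA -[p%:R * lam c]/(rr p c); lra.
have h2 : lam c ^+ N.+1 / N.+1`!%:R <= expR (lam c).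
  by have := expR_ge1Dxn N (ltW l0); lra.
have h3 : expR (- lam c) <= N.+1`!%:R / lam c ^+ N.+1.
  rewrite expRN -[leRHS]invf_div lef_pV2 ?posrE ?expR_gt0// divr_gt0//
    exprn_gt0//.
rewrite /sl; apply: (@le_trans _ _ (N.+1`!%:R / lam c ^+ N.+1 * (4 * p%:R * lam
  c) ^+ N)).
  by rewrite ler_pM ?expR_ge0// sumr_ge0// => u _; rewrite exprn_ge0// rr_ge0.
rewrite exprMn exprS le_eqVlt; apply/orP; left; apply/eqP; field.
by rewrite expf_neq0 gt_eqF.
Qed.

Lemma f_prof_cvgNy : f_prof hp (x : R) @[x --> -oo] --> (1 : R).
Proof.
apply/cvgrPdist_le => e e0.
have [N hN] : exists N, ell_tail R p N <= e / 2.
  have h : N`!%:R^-1 @[N --> \oo] --> (0 : R).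
    have := cvg_series_cvg_0 (@is_cvg_series_exp_coeff R 1).
    by apply: cvg_trans; apply: near_eq_cvg; near=> N;
      rewrite /exp_coeff /= expr1n mul1r.
  near \oo => N; exists N; apply: le_trans (ell_tail_le_invfact R hp N) _.
  near: N; have /cvgr_le := h; apply; by rewrite divr_gt0.
pose K : R := N.+1`!%:R * (4 * p%:R) ^+ N.
have K0 : 0 <= K by rewrite mulr_ge0// exprn_ge0// mulr_ge0.
near=> c.
(* Chosen so that [lam c >= 1 - c] exceeds both 1 and [2 K / e]; then [sl_le] gives [e / 2]. *)
have cle : c <= - (1 + 2 * K / e) by near: c; apply: nbhs_ninfty_le;
  exact: num_real.
have Ke0 : 0 <= 2 * K / e by rewrite divr_ge0 ?mulr_ge0// ltW.
have le1 : 1 + 2 * K / e <= lam c.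
  by rewrite /lam; have := expR_ge1Dx (- c); lra.
have l1 : 1 <= lam c by lra.
have l0 : 0 < lam c by lra.
have sle : sl p c N <= e / 2.
  apply: le_trans (sl_le N l1) _; rewrite -/K ler_pdivrMr//.
  have : 2 * K / e * e <= lam c * e by rewrite ler_wpM2r ?(ltW e0)//; lra.
  by rewrite divfK ?gt_eqF//; lra.
have := f_prof_ge c N; have /andP[f0 f1] := f_prof_bounds c.
have b0 := ell_tail_gt0 R hp N; have s0 := sl_ge0 p c N.
by move=> h; rewrite ger0_norm ?subr_ge0//; nra.
Unshelve. all: by end_near. Qed.

Lemma f_prof_cvgy : f_prof hp (x : R) @[x --> +oo] --> (0 : R).
Proof.
apply: (squeeze_cvgr _ (cvg_cst 0) (@cvgr_expR R)); near=> c.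
by rewrite f_prof_le andbT; have /andP[] := f_prof_bounds c.
Unshelve. all: by end_near. Qed.

Lemma walk_tv_cutoff : tv_cutoff (fun n => Q R n p m)
    (fun n => n%:R / m%:R * ln n%:R) (fun n => n%:R / m%:R).
Proof.
exists (f_prof hp); split.
- by move=> c c'; exact: f_prof_nincr.
- exact: f_prof_bounds.
- exact: f_prof_cvgNy.
- exact: f_prof_cvgy.
- move=> c; have := @cvg_tv R p m hp hm c hp; apply: cvg_trans;
  apply: near_eq_cvg; near=> n.
  by rewrite /kn [c * _]mulrC mulrDr.
Unshelve. all: by end_near. Qed.

End Cutoff.

(** * Strong stationary times *)

Fixpoint hist (M : Type) (mvs : nat -> M) (j : nat) : seq M :=
  if j is i.+1 then mvs i :: hist mvs i else [::].

Lemma size_hist (M : Type) (mvs : nat -> M) j : size (hist mvs j) = j.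
Proof. by elim: j => //= j ->. Qed.

Lemma hist_eq (M : eqType) (mvs : nat -> M) (x0 : M) (s : seq M) j : size s = j
  ->
  (hist mvs j = s) <-> (forall i, (i < j)%N -> mvs i = nth x0 (rev s) i).
Proof.
elim: j s => [|j IH] s; first by move/size0nil => ->.
case: s => //= x s [sj]; rewrite rev_cons; split.
  move=> [<- /IH h] i; rewrite ltnS leq_eqVlt nth_rcons size_rev sj =>
    /orP[/eqP ->|ij].
    by rewrite ltnn eqxx.
  by rewrite ij h.
move=> h; congr (_ :: _).
  by rewrite h// nth_rcons size_rev sj ltnn eqxx.
apply/(IH s sj) => i ij; have := h i (ltnW ij : (i < j.+1)%N).
by rewrite nth_rcons size_rev sj ij.
Qed.

Section Trajectories.
Variables n p m : nat.
Implicit Types mvs : nat -> move n p m.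

Lemma Y_hist mvs j : Y mvs j = run (hist mvs j).
Proof. by elim: j => //= j ->. Qed.

Lemma T_hist mvs j : T mvs j = touched (hist mvs j).
Proof.
rewrite /T /touched; elim: j => [|j IH]; first by rewrite big_ord0 big_nil.
by rewrite big_ord_recr IH /= big_cons finset.setUC.
Qed.

Lemma card_T_nondecreasing mvs i j : (i <= j)%N -> (#|T mvs i| <= #|T mvs j|)%N.
Proof.
move=> /subnK <-; elim: (j - i)%N => // k; rewrite addSn => /leq_trans; apply.
by rewrite !T_hist /touched /= big_cons subset_leq_card// finset.subsetUr.
Qed.

End Trajectories.

Section FirstTime.
Variable E : nat -> bool.
Hypothesis E_incr : forall i j, (i <= j)%N -> E i -> E j.

Lemma first_time_after j : tau_after (first_time E) j = ~~ E j.
Proof.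
rewrite /first_time; case: pselect => [h|h] /=; last first.
  by apply/esym/negP => Ej; apply: h; exists j.
case: ex_minnP => k Ek kmin; rewrite ltnNge; congr negb.
by apply/idP/idP => [/E_incr|]; [apply|exact: kmin].
Qed.

(** Monotonicity of [E] reduces all earlier times to the previous one. *)
Lemma first_time_Some j :
  (first_time E = Some j) <-> E j && (if j is i.+1 then ~~ E i else true).
Proof.
rewrite /first_time; case: pselect => [h|h]; last first.
  by split => // /andP[Ej _]; exfalso; apply: h; exists j.
case: ex_minnP => k Ek kmin; split => [[<-]|/andP[Ej Ei]].
  by rewrite Ek; case: k Ek kmin => // k Ek kmin; apply/negP => /kmin;
    rewrite ltnn.
congr Some; apply/eqP; rewrite eqn_leq kmin//=.
case: j Ej Ei => // j Ej Ei; rewrite ltnNge; apply: contra Ei => kj.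
exact: E_incr Ek.
Qed.

Lemma first_time_None : (first_time E = None) <-> forall j, ~~ E j.
Proof.
rewrite /first_time; case: pselect => [h|h]; split => //.
  by case: h => j Ej /(_ j); rewrite Ej.
by move=> _ j; apply/negP => Ej; apply: h; exists j.
Qed.

End FirstTime.

(** An arbitrary sigma-algebra [S] gives both measurability in [Omega] and membership in the
    filtration of the moves. *)
Lemma sigma_algebra_hist (Omega : Type) (M : finType) (S : set (set Omega))
    (xi : nat -> Omega -> M) j (E : pred (seq M)) : sigma_algebra setT S ->
  (forall i x, (i < j)%N -> S [set w | xi i w = x]) ->
  S [set w | E (hist (xi^~ w) j)].
Proof.
move=> sS; have [S0 SC SU] := sS.
have [ST _ _ SI] : [/\ S setT, setSD_closed S, ndseq_closed S & setI_closed S].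
  by apply: (iffLR (sigma_algebraP _)) sS => // X _; exact: subsetT.
elim: j E => [|j IH] E xiS.
  case: (boolP (E [::])) => E0.
    by rewrite [X in S X](_ : _ = setT)//; apply/seteqP; split.
  by rewrite [X in S X](_ : _ = set0)//; apply/seteqP; split => // w /=;
    rewrite (negbTE E0).
(* Partition by the latest move, indexed by [nat] through [unpickle] to fit countable unions. *)
rewrite [X in S X](_ : _ = \bigcup_k (if unpickle k is Some x then
    [set w | xi j w = x] `&` [set w | E (x :: hist (xi^~ w) j)] else set0)).
  apply: SU => k; case: unpickle => // x; apply: SI; first exact: xiS.
  by apply: (IH (fun s => E (x :: s))) => i y ij; apply: xiS; exact: ltnW.
apply/seteqP; split => w /=.
  by move=> Ew; exists (pickle (xi j w)) => //; rewrite pickleK.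
by move=> [k _]; case: unpickle => // x [/= <-].
Qed.

Section Law.
Variables (R : realType) (d : measure_display) (Omega : measurableType d).
Variable P : probability Omega R.

Lemma probability_partition (I : finType) (f : Omega -> I) (E : pred I) :
  (forall i, measurable [set w | f w = i]) ->
  P [set w | E (f w)] = (\sum_(i | E i) P [set w | f w = i])%E.
Proof.
move=> mf; pose A (s : seq I) := [set w | f w \in s].
have mA s : measurable (A s).
  elim: s => [|i s IH]; first by rewrite (_ : A _ = set0)//; apply/seteqP;
    split.
  rewrite (_ : A _ = [set w | f w = i] `|` A s); first exact: measurableU.
  apply/seteqP; split => w; rewrite /A /= inE; first by case/orP => [/eqP|];
    [left|right].
  by case=> [->|->]; rewrite ?eqxx ?orbT.
have PA s : uniq s -> P (A s) = (\sum_(i <- s) P [set w | f w = i])%E.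
  elim: s => [_|i s IH /= /andP[iNs us]].
    by rewrite big_nil (_ : A _ = set0) ?measure0//; apply/seteqP; split.
  rewrite big_cons -IH// (_ : A _ = [set w | f w = i] `|` A s).
    rewrite measureU//; apply/seteqP; split => // w /= [fi]; rewrite /A /= fi.
    by rewrite (negbTE iNs).
  apply/seteqP; split => w; rewrite /A /= inE; first by case/orP => [/eqP|];
    [left|right].
  by case=> [->|->]; rewrite ?eqxx ?orbT.
rewrite -big_enum -PA ?enum_uniq//; congr (P _); apply/seteqP; split => w;
  rewrite /A /=.
  by rewrite mem_enum.
by rewrite mem_enum.
Qed.

Variables n p m : nat.
Hypothesis mn : (m <= n)%N.
Variable xi : nat -> Omega -> move n p m.
Hypothesis iid : iid_uniform_moves P xi.

Lemma measurable_hist j (E : pred (seq (move n p m))) :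
  measurable [set w | E (hist (xi^~ w) j)].
Proof.
have [mxi _ _] := iid.
by apply: (sigma_algebra_hist E (sigma_algebra_measurable _)) => i x _;
  exact: mxi.
Qed.

Lemma prob_hist j (E : pred (seq (move n p m))) :
  P [set w | E (hist (xi^~ w) j)] = (hist_prob R j E)%:E.
Proof.
have [mxi uxi pxi] := iid.
pose f w : j.-tuple (move n p m) := Tuple (introT eqP (size_hist (xi^~ w) j)).
have fE (s : j.-tuple (move n p m)) : [set w | f w = s] = [set w | hist (xi^~
  w) j == s].
  apply/seteqP; split => w /=; first by move=> <-.
  by move=> /eqP e; apply: val_inj.
have mf s : measurable [set w | f w = s].
  by rewrite fE; exact: (measurable_hist j (fun h => h == s)).
rewrite (_ : [set w | E (hist (xi^~ w) j)] = [set w | E (f w)])//.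
rewrite (probability_partition (fun s : j.-tuple _ => E s) mf).
have /card_gt0P[x0 _] := card_move_gt0 p mn.
have fP (s : j.-tuple (move n p m)) : P [set w | f w = s] = (#|{: move n p
  m}|%:R^-1 ^+ j)%:E.
  rewrite (_ : [set w | f w = s] = [set w | forall i, (i < j)%N -> xi i w = nth
    x0 (rev s) i]).
    rewrite pxi; under eq_bigr => i _ do rewrite uxi /unif finset.inE cardsT
      mul1r.
    rewrite prodEFin; congr (_%:E).
    by rewrite prodr_const card_ord.
  rewrite fE; apply/seteqP; split => w /=.
    by move=> /eqP; apply: (iffLR (hist_eq _ _ _)); rewrite size_tuple.
  by move=> h; apply/eqP/(hist_eq _ x0) => //; rewrite size_tuple.
under eq_bigr do rewrite fP.
rewrite sumEFin; congr (_%:E).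
rewrite sumr_const -[LHS]mulr_natl exprVn /hist_prob; congr (_%:R / _).
by apply: eq_card => s; rewrite !inE.
Qed.

End Law.

Section HProb.
Variables (R : realType) (n p m : nat).
Hypothesis mn : (m <= n)%N.
Implicit Types E : pred (seq (move n p m)).

Lemma hist_probD j E E1 E2 : (forall s, E s = E1 s + E2 s :> nat)%N ->
  hist_prob R j E = hist_prob R j E1 + hist_prob R j E2.
Proof.
move=> h; rewrite /hist_prob -mulrDl !card_histE -big_split/=; congr (_ / _).
by apply: eq_bigr => s _; rewrite -natrD -h.
Qed.

Lemma hist_probC j E : hist_prob R j (fun s => ~~ E s) = 1 - hist_prob R j E.
Proof.
apply/eqP; rewrite eq_sym subr_eq addrC -(hist_probT R p mn j);
  apply/eqP/hist_probD => s.
by case: (E s).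
Qed.

(** From [K] touched labels on, [sorted_from] is the whole group, so for every size of the touched
    set allowed by [E] the conditional law is [U]. *)
Lemma hist_prob_uniform j K y E : (K <= n)%N -> (forall z, z \in sorted_from n
  p K) ->
  (forall x s, E (map (relabel_move x) s) = E s) ->
  (forall s, E s -> (K <= #|touched s|)%N) ->
  hist_prob R j (fun s => (run s == y) && E s) = U R y * hist_prob R j E.
Proof.
move=> Kn WK Einv EK.
pose f (s : seq (move n p m)) : 'I_n.+1 := inord #|touched s|.
have fE s t : (t < n.+1)%N -> (f s == inord t) = (#|touched s| == t).
  by move=> tn; rewrite -val_eqE /= !inordK// ltnS touched_le.
rewrite (hist_prob_partition R f j (fun s => (run s == y) && E s))
  (hist_prob_partition R f j E).
rewrite mulr_sumr; apply: eq_bigr => t _; have tn : (t <= n)%N by rewrite -ltnS.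
have ft s : (f s == t) = (#|touched s| == t) by rewrite -[t in LHS]inord_val fE.
rewrite (@eq_hist_prob _ _ _ _ j _ (fun s => [&& run s == y, #|touched s| == t
  & E s])); last first.
  by move=> s _; rewrite ft andbCA.
rewrite hist_prob_run_touched//.
rewrite [in RHS](@eq_hist_prob _ _ _ _ j _ (fun s => (#|touched s| == t) && E
  s)); last first.
  by move=> s _; rewrite ft.
have [Kt|tK] := leqP K t.
  have Wt z : z \in sorted_from n p t by move: (WK z);
    apply/fintype.subsetP/sorted_from_subset.
  have cW : #|sorted_from n p t| = #|{: cperm n p}| by apply: eq_card => z;
    rewrite Wt.
  by rewrite Wt UE cW mul1r.
rewrite (@eq_hist_prob _ _ _ _ j _ (fun s => predT s && false)); last first.
  move=> s _; apply/negbTE/negP => /andP[/eqP st /EK]; rewrite st; lia.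
by rewrite hist_prob_andb !mulr0.
Qed.

(** Markov's inequality for the number of untouched labels, whose mean is its first factorial
    moment. *)
Lemma hist_prob_card_lt j K : (0 < m)%N -> (K <= n)%N ->
  hist_prob R j (fun s : seq (move n p m) => (#|touched s| < K)%N) <= n%:R * (1
    - m%:R / n%:R) ^+ j.
Proof.
move=> m0 Kn; have n0 : (0 < n)%N by lia.
have h : \sum_(u < n.+1) untouched_prob R n p m j u * 'C(u, 1)%:R <= n%:R * (1
  - m%:R / n%:R) ^+ j.
  rewrite factorial_moment// bin1 ler_wpM2l// lerXn2r ?nnegrE ?avoid_ge0//.
    by rewrite subr_ge0 ler_pdivrMr ?ltr0n// mul1r ler_nat.
  by have := avoid_le R mn 1 n0; rewrite expr1.
apply: le_trans h; rewrite (hist_prob_partition R (fun s : seq (move n p m) =>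
  inord (n - #|touched s|)%N : 'I_n.+1)).
apply: ler_sum => u _; rewrite bin1 /untouched_prob.
have fE (s : seq (move n p m)) : (inord (n - #|touched s|)%N == u :> 'I_n.+1) =
  ((n - #|touched s|)%N == u).
  by rewrite -val_eqE /= inordK// ltnS leq_subr.
have [u0|u0] := posnP u.
  rewrite (@eq_hist_prob _ _ _ _ j _ (fun s => predT s && false))
    ?hist_prob_andb ?u0 ?mulr0// => s _.
  by rewrite fE u0; have := touched_le s; lia.
apply: (@le_trans _ _ (hist_prob R j (fun s : seq (move n p m) => (n -
  #|touched s|)%N == u))); last first.
  by rewrite ler_peMr ?ler1n// /hist_prob.
rewrite /hist_prob ler_wpM2r ?invr_ge0 ?exprn_ge0// ler_nat;
  apply: subset_leq_card.
by apply/fintype.subsetP => s; rewrite !finset.inE fE => /andP[].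
Qed.

(** Inversion permutes the points and [U] is constant, so both minima range over the same values. *)
Lemma sep_inv j : sep (fun y => convpow (Q R n p m) j y^-1%g) (U R) =
  sep (convpow (Q R n p m) j) (U R).
Proof.
have UV (x y : cperm n p) : U R x = U R y by rewrite !UE.
have le_min (f : cperm n p -> R) x0 x : \big[Num.min/x0]_(y : cperm n p) f y <=
  f x.
  exact: bigmin_le_cond.
rewrite /sep; set M := convpow _ j; congr (1 - _); apply/le_anti/andP; split.
  have h x : \big[Num.min/M 1^-1%g / U R 1%g]_(y : cperm n p) (M y^-1%g / U R
    y) <= M x / U R x.
    have := le_min (fun y => M y^-1%g / U R y) (M 1^-1%g / U R 1%g) x^-1%g.
    by rewrite invgK (UV x^-1%g x).
  by apply/bigmin_geP; split=> [|x _]; exact: h.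
have h x : \big[Num.min/M 1%g / U R 1%g]_(y : cperm n p) (M y / U R y) <= M
  x^-1%g / U R x.
  have := le_min (fun y => M y / U R y) (M 1%g / U R 1%g) x^-1%g.
  by rewrite (UV x^-1%g x).
by apply/bigmin_geP; split=> [|x _]; exact: h.
Qed.

End HProb.

Section StrongStationary.
Variables (R : realType) (d : measure_display) (Omega : measurableType d).
Variable P : probability Omega R.
Variables n p m : nat.
Hypotheses (mn : (m <= n)%N) (m0 : (0 < m)%N).
Variable xi : nat -> Omega -> move n p m.
Hypothesis iid : iid_uniform_moves P xi.

Lemma PjE j u : Pj P xi j u = (untouched_prob R n p m j u)%:E.
Proof.
rewrite /Pj -(prob_hist mn iid); congr (P _).
by apply/seteqP; split => w /=; rewrite T_hist => /eqP.
Qed.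

Lemma lawE j : law P (fun w => Y (xi^~ w) j) = fun y => convpow (Q R n p m) j
  y^-1%g.
Proof.
apply/funext => y; rewrite convpow_hist_prob// invgK /law.
rewrite -[RHS]/(fine (hist_prob R j (fun s => run s == y))%:E) -(prob_hist mn
  iid).
congr (fine (P _)); apply/seteqP; split => w /=; rewrite Y_hist;
  first by move=> ->.
by move/eqP.
Qed.

(** Common form of both stopping times: [K = n] for [tau_cov], [K = n - 1] for [tau_pred]. *)
Definition tau_card (K : nat) (mvs : nat -> move n p m) : option nat :=
  first_time (fun j => (K <= #|T mvs j|)%N).

Variable K : nat.

Lemma T_incr (w : Omega) i j : (i <= j)%N ->
  (K <= #|T (xi^~ w) i|)%N -> (K <= #|T (xi^~ w) j|)%N.
Proof. by move=> ij /leq_trans; apply; exact: card_T_nondecreasing. Qed.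

Lemma tau_card_after j :
  P [set w | tau_after (tau_card K (xi^~ w)) j] =
  (1 - hist_prob R j (fun s : seq (move n p m) => (K <= #|touched s|)%N))%:E.
Proof.
rewrite -hist_probC// -(prob_hist mn iid); congr (P _).
apply/seteqP; split => w /=; rewrite /tau_card.
  by rewrite first_time_after ?T_hist//; exact: T_incr.
by rewrite first_time_after ?T_hist//; exact: T_incr.
Qed.

Hypotheses (Kn : (K <= n)%N) (WK : forall z : cperm n p, z \in sorted_from n p
  K).

Lemma tau_card_sst : strong_stationary P xi (fun w => tau_card K (xi^~ w)).
Proof.
split.
- move=> j.
  rewrite [X in _ X](_ : _ = [set w | (fun s : seq (move n p m) => (K <=
    #|touched s|)%N) (hist (xi^~ w) j)]).
    apply: (@sigma_algebra_hist _ _ _ xi j (fun s => (K <= #|touched s|)%N)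
      (smallest_sigma_algebra _ _)) => i x ij.
    by apply: sub_sigma_algebra; exists i, x.
  apply/seteqP; split => w /=; rewrite /tau_card first_time_after ?negbK
    ?T_hist//; exact: T_incr.
- pose A j := [set w | (fun s : seq (move n p m) => (#|touched s| < K)%N) (hist
  (xi^~ w) j)].
  have mA j : measurable (A j) by exact: (measurable_hist iid j (fun s =>
    (#|touched s| < K)%N)).
  have -> : [set w | tau_card K (xi^~ w) = None] = \bigcap_j A j.
    apply/seteqP; split => w /=; rewrite /tau_card first_time_None => h j.
      by move=> _; rewrite /A /= -T_hist ltnNge.
    by have := h j Logic.I; rewrite /A /= -T_hist ltnNge.
  have mI : measurable (\bigcap_j A j) by exact: bigcapT_measurable.
  have le_e j : (P (\bigcap_j A j) <= (n%:R * (1 - m%:R / n%:R) ^+ j)%:E)%E.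
    apply: (@le_trans _ _ (P (A j))).
      by apply: le_measure; rewrite ?inE//; exact: bigcap_inf.
    by rewrite (prob_hist mn iid) lee_fin hist_prob_card_lt.
  have n0 : (0 < n)%N by lia.
  have r0 : 0 <= 1 - m%:R / n%:R :> R by rewrite subr_ge0 ler_pdivrMr ?ltr0n//
    mul1r ler_nat.
  have r1 : 1 - m%:R / n%:R < 1 :> R by rewrite ltrBlDr ltrDl divr_gt0 ?ltr0n.
  have cv : n%:R * (1 - m%:R / n%:R) ^+ j @[j --> \oo] --> (0 : R).
    rewrite -(mulr0 n%:R); apply: cvgM; first exact: cvg_cst.
    by apply: cvg_expr; rewrite ger0_norm.
  apply/eqP; rewrite eq_le measure_ge0 andbT; apply/lee_addgt0Pr => e e0;
    rewrite add0e.
  near \oo => j; apply: le_trans (le_e j) _; rewrite lee_fin.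
  near: j; have /cvgr_le := cv; exact.
- move=> y j.
  (* First arrival at [K], read on the history: [s'] drops the latest move, and at time 0 there is
     no earlier state. *)
  pose E (s : seq (move n p m)) := (K <= #|touched s|)%N && (if s is _ :: s'
    then (#|touched s'| < K)%N else true).
  have tauE w : tau_card K (xi^~ w) = Some j <-> E (hist (xi^~ w) j).
    rewrite /tau_card first_time_Some; last exact: T_incr.
    by case: j => [|j]; rewrite /E !T_hist //= -ltnNge.
  have -> : [set w | Y (xi^~ w) j = y] `&` [set w | tau_card K (xi^~ w) = Some
    j] =
      [set w | (fun s => (run s == y) && E s) (hist (xi^~ w) j)].
    apply/seteqP; split => w /=; first by move=> [<- /tauE ->];
      rewrite Y_hist eqxx.
    by move=> /andP[/eqP <- /tauE ->]; rewrite Y_hist.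
  have -> : [set w | tau_card K (xi^~ w) = Some j] = [set w | E (hist (xi^~ w)
    j)].
    by apply/seteqP; split => w /= /tauE.
  rewrite (prob_hist mn iid j (fun s => (run s == y) && E s)) (prob_hist mn iid
    j E) -EFinM.
  congr (_%:E).
  apply: (hist_prob_uniform R mn _ _ Kn WK) => [x [|mv s]|s /andP[]//].
    by [].
  by rewrite /E /= (card_touched_relabel x (mv :: s)) card_touched_relabel.
Unshelve. all: by end_near. Qed.

End StrongStationary.

Section Optimal.
Variables (R : realType) (d : measure_display) (Omega : measurableType d).
Variable P : probability Omega R.
Variables n p m : nat.
Hypotheses (mn : (m <= n)%N) (m0 : (0 < m)%N) (hp : (0 < p)%N).
Variable xi : nat -> Omega -> move n p m.
Hypothesis iid : iid_uniform_moves P xi.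

Lemma tau_covE (mvs : nat -> move n p m) : tau_cov mvs = tau_card n mvs.
Proof.
congr first_time; apply/funext => j.
by rewrite eqEcard finset.subsetT cardsT card_ord.
Qed.

Lemma hist_prob_full j : hist_prob R j (fun s : seq (move n p m) => (n <=
  #|touched s|)%N) =
  density R n p m j 0.
Proof.
rewrite /density big_ord1 fact0 expr0 mulr1 mulr1; apply: eq_hist_prob => s _.
by rewrite -subn_eq0.
Qed.

Lemma hist_prob_pred j : hist_prob R j (fun s : seq (move n p m) => (n.-1 <=
  #|touched s|)%N) =
  untouched_prob R n p m j 0 + untouched_prob R n p m j 1.
Proof. by apply: hist_probD => // s; have := touched_le s; lia. Qed.

Lemma optimal_of_after (tau : Omega -> option nat) : strong_stationary P xi tau
  ->
  (forall j, P [set w | tau_after (tau w) j] = (sep (convpow (Q R n p m) j) (U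
    R))%:E) ->
  optimal_sst P xi tau.
Proof. by move=> sst h; split=> // j; rewrite (lawE mn iid) sep_inv// h. Qed.

Lemma cov_optimal : (2 <= p)%N ->
  optimal_sst P xi (fun w => tau_cov (xi^~ w)) /\
  forall j : nat,
    P [set w | tau_after (tau_cov (xi^~ w)) j] = (1 - Pj P xi j 0)%E /\
    (1 - Pj P xi j 0)%E = (sep (convpow (Q R n p m) j) (U R))%:E.
Proof.
move=> p2; have n0 : (0 < n)%N by lia.
have p1 : (p == 1%N) = false by lia.
have -> : (fun w => tau_cov (xi^~ w)) = (fun w => tau_card n (xi^~ w)).
  by apply/funext => w; exact: tau_covE.
have D0 j : density R n p m j 0 = untouched_prob R n p m j 0.
  by rewrite /density big_ord1 fact0 expr0 mulr1 mulr1.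
have after j : P [set w | tau_after (tau_card n (xi^~ w)) j] = (1 - Pj P xi j
  0)%E.
  by rewrite (tau_card_after mn iid) hist_prob_full (PjE mn iid) D0 EFinB.
have sepj j : (1 - Pj P xi j 0)%E = (sep (convpow (Q R n p m) j) (U R))%:E.
  by rewrite (PjE mn iid) sepE// p1 D0 EFinB.
split; last first.
  move=> j; split; last exact: sepj.
  by rewrite -after; congr (P _); apply/seteqP; split => w /=; rewrite tau_covE.
apply: optimal_of_after => [|j]; last by rewrite after sepj.
by apply: (tau_card_sst mn m0 iid) => // z; exact: mem_sorted_from_full.
Qed.

Lemma pred_optimal : p = 1%N ->
  optimal_sst P xi (fun w => tau_pred (xi^~ w)) /\
  forall j : nat,
    P [set w | tau_after (tau_pred (xi^~ w)) j] = (1 - Pj P xi j 0 - Pj P xi j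
      1)%E /\
    (1 - Pj P xi j 0 - Pj P xi j 1)%E = (sep (convpow (Q R n p m) j) (U R))%:E.
Proof.
move=> p1; have n0 : (0 < n)%N by lia.
have pE : (p == 1%N) = true by lia.
have D1 j : density R n p m j 1 = untouched_prob R n p m j 0 + untouched_prob R
  n p m j 1.
  by rewrite /density big_ord_recl big_ord1 /= p1 fact0 expr0 expr1 !mulr1.
(* A tail of one card is increasing, and for [p = 1] the only color is 0. *)
have WK (z : cperm n p) : z \in sorted_from n p n.-1.
  apply/mem_sorted_fromP; split => [i k|k] ik; first by have := ltn_ord k; lia.
  by apply: val_inj => /=; have := ltn_ord (z.1 k); lia.
have after j : P [set w | tau_after (tau_pred (xi^~ w)) j] =
    (1 - Pj P xi j 0 - Pj P xi j 1)%E.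
  rewrite [LHS](tau_card_after mn iid) hist_prob_pred !(PjE mn iid).
  by rewrite -!EFinB opprD addrA.
have sepj j : (1 - Pj P xi j 0 - Pj P xi j 1)%E = (sep (convpow (Q R n p m) j)
  (U R))%:E.
  by rewrite !(PjE mn iid) sepE// pE /= D1 -!EFinB opprD addrA.
split; last by move=> j.
apply: optimal_of_after => [|j]; last by rewrite after sepj.
apply: (tau_card_sst mn m0 iid) => //; lia.
Qed.

End Optimal.

Theorem theorem1p3 (R : realType) (c : R) (p m : nat)
    (hp : (0 < p)%N) (hm : (0 < m)%N) :
  (sep (convpow (Q R n p m) (kn m c n)) (U R) @[n --> \oo] --> s_prof p c) /\
  (forall q : R, 1 <= q ->
     (lq_norm q (reldens (convpow (Q R n p m) (kn m c n)))) `^ q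
       @[n --> \oo] --> Hq_prof q p c) /\
  (KL (convpow (Q R n p m) (kn m c n)) (U R) @[n --> \oo] --> h_prof p c) /\
  ((linf_norm (reldens (convpow (Q R n p m) (kn m c n))))%:E
     @[n --> \oo] --> Hinf_prof p c) /\
  (tv (convpow (Q R n p m) (kn m c n)) (U R) @[n --> \oo] --> f_prof hp c) /\
  (chi2 (convpow (Q R n p m) (kn m c n)) @[n --> \oo] --> g_prof p c) /\
  tv_cutoff (fun n => Q R n p m)
    (fun n => n%:R / m%:R * ln n%:R) (fun n => n%:R / m%:R) /\
  (forall (n : nat) (d : measure_display) (Omega : measurableType d)
     (P : probability Omega R) (xi : nat -> Omega -> move n p m),
     (m <= n)%N -> iid_uniform_moves P xi ->
     ((2 <= p)%N ->
        optimal_sst P xi (fun w => tau_cov (xi^~ w)) /\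
        forall j : nat,
          P [set w | tau_after (tau_cov (xi^~ w)) j] = (1 - Pj P xi j 0)%E /\
          (1 - Pj P xi j 0)%E = (sep (convpow (Q R n p m) j) (U R))%:E) /\
     (p = 1%N ->
        optimal_sst P xi (fun w => tau_pred (xi^~ w)) /\
        forall j : nat,
          P [set w | tau_after (tau_pred (xi^~ w)) j]
            = (1 - Pj P xi j 0 - Pj P xi j 1)%E /\
          (1 - Pj P xi j 0 - Pj P xi j 1)%E
            = (sep (convpow (Q R n p m) j) (U R))%:E)).
Proof.
split; first exact: cvg_sep.
split; first by move=> q q1; exact: cvg_lq.
split; first exact: cvg_KL.
split; first exact: cvg_linf.
split; first exact: cvg_tv.
split; first exact: cvg_chi2.
split; first exact: walk_tv_cutoff.
move=> n d Omega P xi mn iid; split.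
  exact: cov_optimal mn hm hp xi iid.
exact: pred_optimal mn hm hp xi iid.
Qed.
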